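(* Let $\mathbb{F}_{2^d}$ be the finite field of order $2^d$, $d\ge 1$, represented as $\mathbb{Z}_2[x]/\langle g_2\rangle$ with $g_2\in\mathbb{Z}_2[x]$ irreducible of degree $d$. There is a randomized algorithm that correctly computes the parity cycle cover enumerator $\operatorname{pcc}_{n-1}A$ of a given matrix $A\in\mathbb{F}_{2^d}^{n\times n}$ in $\tilde O(n^{2+\omega}d)$ time and with probability at least $1-2^{1-d}n^3$.
   Context: For an $n\times n$ matrix $A$ over a commutative ring and an integer $m$, the parity cycle cover enumerator with parity $m$ is $$\operatorname{pcc}_m A=\sum_{\substack{C\\ \kappa(C)\equiv m\pmod 2}}\ \prod_{uv\in C}A_{u,v},$$ where $C$ ranges over the cycle covers of the directed graph (with a loop at every vertex) whose vertices index the rows and columns of $A$ and whose arc weights are the entries of $A$. A cycle cover is a set of arcs with exactly one arc leading into and exactly one arc leading out of each vertex, and $\kappa(C)$ is the number of directed cycles of $C$, loops counting as cycles. Equivalently, the sum ranges over all permutations $f\in S_n$ whose number of cycles (fixed points included) is congruent to $m$ modulo $2$, with terms $\prod_{i=1}^n A_{i,f(i)}$. Arithmetic operations in $\mathbb{F}_{2^d}$ take $\tilde O(d)$ time each, given $g_2$. The notation $\tilde O(\cdot)$ suppresses polylogarithmic factors, and $\omega$ is the square matrix multiplication exponent. *)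

(* Defs.v *)
From HB Require Import structures.
From mathcomp Require Import all_boot all_order all_algebra all_field.
From mathcomp Require Import boolp classical_sets reals exp.

Set Implicit Arguments.
Unset Strict Implicit.
Unset Printing Implicit Defensive.

Import Order.TTheory GRing.Theory Num.Theory.
Local Open Scope ring_scope.

Definition cycle_cover n (C : {set 'I_n * 'I_n}) : bool :=
  [forall v, #|[set u | (u, v) \in C]| == 1%N] &&
  [forall u, #|[set v | (u, v) \in C]| == 1%N].

(* The directed cycles of a cover C are vertex-disjoint and the one through u
   has as vertices exactly those reachable from u, so they are counted by
   their vertex sets; a loop contributes a singleton. *)
Definition num_cycles n (C : {set 'I_n * 'I_n}) : nat :=
  #|[set [set v | connect [rel x y | (x, y) \in C] u v]%SET | u in 'I_n]%SET|.

Definition pcc (K : comNzRingType) (m : int) n (A : 'M[K]_n) : K :=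
  \sum_(C : {set 'I_n * 'I_n} |
          cycle_cover C && ((num_cycles C)%:Z == m %[mod 2])%Z)
    \prod_(uv in C) A uv.1 uv.2.

(* Row-major listing. *)
Definition entries (T : Type) n (A : 'M[T]_n) : seq T :=
  [seq A i j | i <- enum 'I_n, j <- enum 'I_n].

(* Over Z_2 an irreducible polynomial is monic. *)
Lemma irreducible_F2_monic (g : {poly 'F_2}) :
  irreducible_poly g -> monic_irreducible_poly g.
Proof.
move=> irr_g; split=> //; rewrite monicE.
have: lead_coef g != 0 by rewrite lead_coef_eq0 irredp_neq0.
by case: (lead_coef g) => [[|[|m]] //= ltm] _; apply/eqP/val_inj.
Qed.

Definition F2quot (g : {poly 'F_2}) (irr_g : irreducible_poly g) :
    finFieldType :=
  {poly %/ g with irreducible_F2_monic irr_g}.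

(* Matrix multiplication exponent: n x n matrices are multiplied by
   straight-line programs over K, whose length counts every ring operation.
   Correctness is required over all commutative K-algebras, that is, for
   matrices of indeterminates. *)

Inductive slp_instr (K : Type) :=
| SConst of K
| SAdd of nat & nat
| SSub of nat & nat
| SMul of nat & nat.

Definition slp_step (K : comNzRingType) (S : comAlgType K)
    (vs : seq S) (i : slp_instr K) : seq S :=
  rcons vs match i with
           | SConst c => c%:A
           | SAdd a b => vs`_a + vs`_b
           | SSub a b => vs`_a - vs`_b
           | SMul a b => vs`_a * vs`_b
           end.

Definition slp_multiplies (K : comNzRingType) n (p : seq (slp_instr K)) : Prop :=
  exists out : 'I_n -> 'I_n -> nat, forall (S : comAlgType K) (A B : 'M[S]_n),
    forall i j,
      (foldl (@slp_step K S) (entries A ++ entries B) p)`_(out i j) =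
      (A *m B) i j.

Definition mm_exponent (R : realType) (K : comNzRingType) : R :=
  inf [set t : R | exists c : R, forall n, (0 < n)%N ->
         exists2 p : seq (slp_instr K),
           slp_multiplies n p & (size p)%:R <= c * n%:R `^ t]%classic.

(* The exponent over a field depends only on its characteristic, so this one
   serves all the fields F_{2^d}. *)
Definition omega (R : realType) : R := mm_exponent R 'F_2.

(* C x log^k(2 + x): a function is soft-O of x when it is bounded in this way
   for some constants C and k. *)
Definition soft (R : realType) (C : R) (k : nat) (x : R) : R :=
  C * x * ln (2 + x) ^+ k.

(* Randomized random-access machine over a field F. The natural-number memory
   is used for control and addressing, at logarithmic cost; the second memory
   holds elements of F, and w is the time of one operation in F. Random field
   elements are consumed from a tape. *)

Record state (F : Type) := State {
  imem : nat -> nat;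
  fmem : nat -> F;
  tape : seq F }.

Inductive iop := Iadd | Isub | Imul.
Inductive fop := Fadd | Fsub | Fmul | Fdiv.

Inductive instr :=
| Iset of nat & nat
| Iop of iop & nat & nat & nat
| Iload of nat & nat
| Istore of nat & nat
| Fset of nat & bool
| Fop of fop & nat & nat & nat
| Fload of nat & nat
| Fstore of nat & nat
| Fsample of nat.

Inductive test :=
| Tlt of nat & nat
| Tfzero of nat.

Inductive cmd :=
| Skip
| Basic of instr
| Seq of cmd & cmd
| If of test & cmd & cmd
| While of test & cmd.

Definition iop_fun (o : iop) : nat -> nat -> nat :=
  match o with Iadd => addn | Isub => subn | Imul => muln end.

Definition fop_fun (F : fieldType) (o : fop) (a b : F) : F :=
  match o with
  | Fadd => a + b | Fsub => a - b | Fmul => a * b | Fdiv => a / b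
  end.

Definition set_icell (F : Type) (s : state F) (x v : nat) : state F :=
  State [eta imem s with x |-> v] (fmem s) (tape s).

Definition set_fcell (F : Type) (s : state F) (x : nat) (v : F) : state F :=
  State (imem s) [eta fmem s with x |-> v] (tape s).

(* None when a random element is requested and the tape is exhausted. *)
Definition effect (F : fieldType) (i : instr) (s : state F) :
    option (state F) :=
  match i with
  | Iset x k => Some (set_icell s x k)
  | Iop o x y z => Some (set_icell s x (iop_fun o (imem s y) (imem s z)))
  | Iload x y => Some (set_icell s x (imem s (imem s y)))
  | Istore x y => Some (set_icell s (imem s x) (imem s y))
  | Fset x b => Some (set_fcell s x (b%:R))
  | Fop o x y z => Some (set_fcell s x (fop_fun o (fmem s y) (fmem s z)))
  | Fload x y => Some (set_fcell s x (fmem s (imem s y)))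
  | Fstore x y => Some (set_fcell s (imem s x) (fmem s y))
  | Fsample x =>
      if tape s is v :: r
      then Some (State (imem s) [eta fmem s with x |-> v] r) else None
  end.

Definition holds (F : fieldType) (b : test) (s : state F) : bool :=
  match b with
  | Tlt x y => (imem s x < imem s y)%N
  | Tfzero x => fmem s x == 0
  end.

(* Bit length, with bitlen 0 = 1. *)
Definition bitlen (k : nat) : nat := (trunc_log 2 k).+1.

(* Integer multiplication is charged as by the schoolbook method. *)
Definition iop_cost (o : iop) (a b : nat) : nat :=
  match o with
  | Imul => bitlen a * bitlen b
  | _ => bitlen a + bitlen b
  end.

(* Every address and every integer handled is charged its bit length; moving,
   sampling and testing a field element are charged as arithmetic. *)
Definition instr_cost (F : fieldType) (w : nat) (i : instr) (s : state F) :
    nat :=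
  match i with
  | Iset x k => bitlen x + bitlen k
  | Iop o x y z =>
      bitlen x + bitlen y + bitlen z + iop_cost o (imem s y) (imem s z)
  | Iload x y =>
      bitlen x + bitlen y + bitlen (imem s y) + bitlen (imem s (imem s y))
  | Istore x y =>
      bitlen x + bitlen y + bitlen (imem s x) + bitlen (imem s y)
  | Fset x _ => bitlen x + w
  | Fop _ x y z => bitlen x + bitlen y + bitlen z + w
  | Fload x y => bitlen x + bitlen y + bitlen (imem s y) + w
  | Fstore x y => bitlen x + bitlen y + bitlen (imem s x) + w
  | Fsample x => bitlen x + w
  end.

Definition test_cost (F : fieldType) (w : nat) (b : test) (s : state F) : nat :=
  match b with
  | Tlt x y => bitlen x + bitlen y + bitlen (imem s x) + bitlen (imem s y)
  | Tfzero x => bitlen x + w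
  end.

(* exec w c s t s': command c, started in s, halts in s' after time t. *)
Inductive exec (F : fieldType) (w : nat) :
    cmd -> state F -> nat -> state F -> Prop :=
| ExecSkip s : exec w Skip s 1 s
| ExecBasic i s s' of effect i s = Some s' :
    exec w (Basic i) s (instr_cost w i s) s'
| ExecSeq c1 c2 s s1 s2 t1 t2 of exec w c1 s t1 s1 & exec w c2 s1 t2 s2 :
    exec w (Seq c1 c2) s (t1 + t2) s2
| ExecIf b c1 c2 s s' t of exec w (if holds b s then c1 else c2) s t s' :
    exec w (If b c1 c2) s (test_cost w b s + t) s'
| ExecWhileF b c s of ~~ holds b s :
    exec w (While b c) s (test_cost w b s) s
| ExecWhileT b c s s1 s2 t1 t2 of
    holds b s & exec w c s t1 s1 & exec w (While b c) s1 t2 s2 :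
    exec w (While b c) s (test_cost w b s + t1 + t2) s2.

(* Integer cells 0 and 1 hold n and d, entry (i, j) of A is in field cell
   i * n + j, and all other cells are zero. *)
Definition initial (F : fieldType) (d n : nat) (A : 'M[F]_n) (r : seq F) :
    state F :=
  State (nth 0%N [:: n; d]) (nth 0 (entries A)) r.

(* The result is the content of field cell 0 on halting. *)
Definition returns_within (F : fieldType) (w : nat) (P : cmd) (s : state F)
    (T : nat) (y : F) : Prop :=
  exists t s', [/\ exec w P s t s', (t <= T)%N & fmem s' 0%N = y].

(* Probability of E under the uniform distribution on X. *)
Definition Pr (R : realType) (X : finType) (E : X -> Prop) : R :=
  #|[pred x | `[< E x >]]|%:R / #|X|%:R.

(* Main.v *)
(** The number of cycles of a cycle cover has the parity of n - 1 exactly when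
    its permutation is odd, so pcc_(n-1) A is the sum of prod_i A_(i, s i) over
    the odd s. If X is invertible with inverse M, replacing row j of X by row i
    gives a matrix whose odd sum is, in characteristic 2,
    det X * sum_k X_(i,k)^2 M_(k,i) M_(k,j): the odd sum of a matrix with two
    equal rows is a sum of products of two entries with a complementary minor,
    and by Jacobi these minors are det X times 2 x 2 minors of M. The odd sum is
    linear in each row, so the rows of the identity can be replaced one at a
    time by those of B while M, the determinant and the odd sum are maintained.
    This takes O(n^3) operations and works when no intermediate matrix is
    singular.

    It is applied to B = A + x I for n random values of x. The odd sum of
    A + x I is a polynomial in x of degree less than n, as an odd permutation
    moves a point, and Lagrange interpolation at x = 0 recovers that of A. A
    value x is bad only if it is a root of one of n characteristic polynomials,
    so some value is bad or two values coincide with probability at most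
    n (n^2 + n - 1) / 2^d <= 2 n^3 / 2^d.

    The whole computation uses O(n^4) field operations, which is within the
    bound because omega >= 2: a program multiplying n x n matrices has n^2
    distinct outputs. No fast matrix multiplication is needed. *)
Require Import Defs.
From HB Require Import structures.
From mathcomp Require Import all_boot all_order all_algebra all_field.
From mathcomp Require Import all_fingroup.
From mathcomp Require Import boolp classical_sets reals exp.
From mathcomp Require Import zify ring lra.

Set Implicit Arguments.
Unset Strict Implicit.
Unset Printing Implicit Defensive.

Import Order.TTheory GRing.Theory Num.Theory.
Local Open Scope ring_scope.

(** * Odd permutation sums in characteristic 2 *)


Definition oddsum (K : comNzRingType) n (A : 'M[K]_n) : K :=
  \sum_(s : 'S_n | odd_perm s) \prod_i A i (s i).

Definition set_row (K : Type) n (X : 'M[K]_n) (j : 'I_n) (a : 'I_n -> K) : 'M[K]_n :=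
  \matrix_(r, k) if r == j then a k else X r k.

Section Rows.
Variables (K : comNzRingType) (n : nat).
Implicit Types (X M A : 'M[K]_n) (s : 'S_n).

Lemma set_row_id X j : set_row X j (X j) = X.
Proof. by apply/matrixP=> r k; rewrite mxE; case: eqP => [->|]. Qed.

Lemma prod_set_row X j a s :
  \prod_i set_row X j a i (s i) = a (s j) * \prod_(i | i != j) X i (s i).
Proof.
rewrite (bigD1 j) //= mxE eqxx; congr (_ * _).
by apply: eq_bigr => i /negPf nij; rewrite mxE nij.
Qed.

Lemma oddsum_set_row_sum X j (c : 'I_n -> K) (v : 'I_n -> 'I_n -> K) :
  oddsum (set_row X j (fun k => \sum_i c i * v i k)) =
  \sum_i c i * oddsum (set_row X j (v i)).
Proof.
rewrite /oddsum; under [RHS]eq_bigr do rewrite big_distrr.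
rewrite exchange_big; apply: eq_bigr => s _ /=.
rewrite prod_set_row big_distrl; apply: eq_bigr => i _ /=.
by rewrite prod_set_row mulrA.
Qed.

Lemma odd_perm_moves s : odd_perm s -> exists i, s i != i.
Proof.
move=> odd_s; apply/existsP; apply: contraLR odd_s; rewrite negb_exists => /forallP fix_s.
suff -> : s = 1%g by rewrite odd_perm1.
by apply/permP=> i; rewrite perm1; apply/eqP/negPn.
Qed.

Lemma oddsum1 : oddsum (1%:M : 'M[K]_n) = 0.
Proof.
apply: big1 => s odd_s.
have [i nsi] := odd_perm_moves odd_s.
by rewrite (bigD1 i) //= mxE eq_sym (negPf nsi) mul0r.
Qed.

(** Injectivity keeps the images of [i] and [j] away from the fixed points, so [s] permutes these
    two indices. *)
Lemma perm_fix2 s i j : i != j ->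
  (forall m, m != i -> m != j -> s m = m) -> s = 1%g \/ s = tperm i j.
Proof.
move=> nij fix_s.
have im m : (m == i) || (m == j) -> (s m == i) || (s m == j).
  apply: contraTT; rewrite !negb_or => /andP[n1 n2].
  by have /perm_inj <- := fix_s _ n1 n2; rewrite n1.
have /orP[/eqP si|/eqP si] := im i (predU1l _ (erefl _)).
  left; apply/permP=> m; rewrite perm1.
  case: (eqVneq m i) => [->//|nmi]; case: (eqVneq m j) => [mj|]; last exact: fix_s.
  have := im m; rewrite mj eqxx orbT => /(_ isT)/orP[/eqP sj|/eqP//].
  by have := perm_inj (etrans si (esym sj)) => /eqP; rewrite (negPf nij).
right; apply/permP=> m; case: tpermP => [->//|->|/eqP n1 /eqP n2]; last exact: fix_s.
have := im j; rewrite eqxx orbT => /(_ isT)/orP[/eqP//|/eqP sj].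
by have := perm_inj (etrans si (esym sj)) => /eqP; rewrite (negPf nij).
Qed.

Lemma prod_set_row2 X i j a b s : i != j ->
  \prod_m set_row (set_row X i a) j b m (s m) =
  a (s i) * b (s j) * \prod_(m | (m != j) && (m != i)) X m (s m).
Proof.
move=> nij; rewrite prod_set_row (bigD1 i) //= mxE eqxx mulrCA mulrA.
congr (_ * _); apply: eq_bigr => m /andP[_ /negPf nmi].
by rewrite mxE nmi.
Qed.

(** Only the identity and the transposition contribute: any other permutation moves a point whose
    row is a unit row. *)
Lemma det_two_rows i j (a b : 'I_n -> K) : i != j ->
  \det (set_row (set_row 1%:M i a) j b) = a i * b j - a j * b i.
Proof.
move=> nij; rewrite /determinant (bigD1 1%g) //= (bigD1 (tperm i j)) /=; last first.
  by apply/eqP => /(congr1 (@odd_perm _)); rewrite odd_tperm odd_perm1 nij.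
rewrite [X in _ + (_ + X)]big1 => [|s /andP[n1 nt]].
  rewrite odd_perm1 odd_tperm nij expr0 expr1 mul1r mulN1r addr0.
  rewrite !prod_set_row2 // !perm1 tpermL tpermR; congr (_ - _).
    by rewrite big1 ?mulr1 // => m _; rewrite mxE perm1 eqxx.
  rewrite big1 ?mulr1 // => m /andP[nmj nmi].
  by rewrite mxE tpermD ?eqxx // eq_sym.
have [m /and3P[nmi nmj nsm]]: exists m, [&& m != i, m != j & s m != m].
  apply/existsP; apply: contraNT n1; rewrite negb_exists => /forallP fix_s.
  have [|/eqP//|st] := perm_fix2 (s := s) nij; last by rewrite st eqxx in nt.
  move=> m nmi nmj; apply/eqP; have := fix_s m.
  by rewrite nmi nmj /= negbK.
rewrite prod_set_row2 // (bigD1 m) ?nmi ?nmj //= mxE eq_sym (negPf nsm).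
by rewrite mul0r !mulr0.
Qed.

Lemma mul_set_row X j a M :
  set_row X j a *m M = set_row (X *m M) j (fun i => \sum_k a k * M k i).
Proof.
apply/matrixP=> r i; rewrite !mxE; case: eqP => [->|/eqP/negPf nrj].
  by apply: eq_bigr => k _; rewrite mxE eqxx.
by apply: eq_bigr => k _; rewrite mxE nrj.
Qed.

Lemma det_set_row1 j (a : 'I_n -> K) : \det (set_row 1%:M j a) = a j.
Proof.
rewrite (expand_det_row _ j) (bigD1 j) //= big1 ?addr0 => [|k nkj].
  rewrite mxE eqxx /cofactor addnn -signr_odd odd_double expr0 mul1r.
  rewrite [X in \det X](_ : _ = 1%:M) ?det1 ?mulr1 //.
  apply/matrixP=> r k; rewrite !mxE eq_sym (negPf (neq_lift _ _)).
  by rewrite (inj_eq (@lift_inj _ j)).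
have njk : j != k by rewrite eq_sym.
have [k' -> _] := unlift_some njk.
rewrite /cofactor (expand_det_row _ k') big1 ?mulr0 // => l _.
rewrite !mxE eq_sym (negPf (neq_lift _ _)).
by rewrite (negPf (neq_lift _ _)) mul0r.
Qed.

(** Cramer's rule: multiplying by [M] on the right gives the identity with row [j] replaced by
    [a M], whose determinant is its entry at [j]. *)
Lemma det_set_row X M j a : X *m M = 1%:M ->
  \det (set_row X j a) = (\sum_k a k * M k j) * \det X.
Proof.
move=> XM; have MX := mulmx1C XM.
rewrite -[set_row X j a in LHS]mulmx1 -MX mulmxA det_mulmx mul_set_row XM.
by rewrite det_set_row1.
Qed.

End Rows.

Section Char2.
Variables (K : fieldType) (n : nat).
Hypothesis K2 : (1 + 1 = 0 :> K).
Implicit Types (X M A : 'M[K]_n) (s : 'S_n).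

Lemma addrr2 (x : K) : x + x = 0.
Proof. by rewrite -[x]mulr1 -mulrDr K2 mulr0. Qed.

Lemma oppr2 (x : K) : - x = x.
Proof. by apply/eqP; rewrite -subr_eq0 -opprD addrr2 oppr0. Qed.

Lemma det_perm2 X : \det X = \sum_(s : 'S_n) \prod_i X i (s i).
Proof.
apply: eq_bigr => s _; rewrite oppr2; by rewrite expr1n mul1r.
Qed.

Lemma oddsum_eq_rows X M i j : i != j -> X *m M = 1%:M ->
  oddsum (set_row X j (X i)) = \det X * \sum_k X i k ^+ 2 * M k i * M k j.
Proof.
move=> nij XM.
pose rest s := \prod_(m | (m != j) && (m != i)) X m (s m).
pose W k l := \sum_(s : 'S_n | (s i == k) && (s j == l)) rest s.
(* Jacobi's identity for complementary minors: [W k l] is the determinant of [X] with rows [i] and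
   [j] replaced by unit rows, and multiplying by [M] turns it into a 2 x 2 minor of [M]. Signs
   vanish in characteristic 2. *)
have WE k l : W k l = \det X * (M k i * M l j + M l i * M k j).
  pose Z := set_row (set_row X i (fun m => (k == m)%:R)) j (fun m => (l == m)%:R).
  have <- : \det Z = W k l.
    rewrite det_perm2 /W [RHS]big_mkcond; apply: eq_bigr => s _.
    rewrite prod_set_row2 // -/(rest s).
    rewrite !(eq_sym _ (s _)).
    by case: (s i == k); case: (s j == l); rewrite /= ?mul1r ?mul0r.
  have MX := mulmx1C XM.
  rewrite -[Z]mulmx1 -MX mulmxA det_mulmx mulrC; congr (_ * _).
  rewrite !mul_set_row XM det_two_rows // oppr2.
  have sumE (m p : 'I_n) : \sum_q (m == q)%:R * M q p = M m p.
    rewrite (bigD1 m) //= eqxx mul1r big1 ?addr0 // => q nq.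
    by rewrite eq_sym (negPf nq) mul0r.
  by rewrite !sumE [X in _ + X]mulrC.
pose f s := X i (s i) * X i (s j) * rest s.
have fE : oddsum (set_row X j (X i)) = \sum_(s : 'S_n | odd_perm s) f s.
  apply: eq_bigr => s _; rewrite prod_set_row (bigD1 i) //= mulrA.
  by rewrite [X in X * _]mulrC.
have ft s : f (tperm i j * s)%g = f s.
  rewrite /f !permM tpermL tpermR [X in X * _]mulrC; congr (_ * _).
  by apply: eq_bigr => m /andP[n1 n2]; rewrite permM tpermD // eq_sym.
(* tperm i j pairs the odd s having s i > s j with the even s having s i < s j. *)
have {fE ft} -> : oddsum (set_row X j (X i)) = \sum_(s : 'S_n | (s i < s j)%N) f s.
  rewrite fE (bigID (fun s : 'S_n => (s i < s j)%N)) /= [RHS](bigID (@odd_perm _)) /=.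
  congr (_ + _); first by apply: eq_bigl => s; rewrite andbC.
  rewrite (reindex_inj (mulgI (tperm i j))) /=; apply: eq_big => [s|s _]; last exact: ft.
  rewrite odd_mul_tperm nij /= !permM tpermL tpermR -leqNgt andbC; congr (_ && _).
  by rewrite leq_eqVlt (inj_eq val_inj) (inj_eq perm_inj) (negPf nij).
have -> : \sum_(s : 'S_n | (s i < s j)%N) f s =
          \sum_(kl : 'I_n * 'I_n | (kl.1 < kl.2)%N) X i kl.1 * X i kl.2 * W kl.1 kl.2.
  rewrite (partition_big (fun s : 'S_n => (s i, s j)) (fun kl : 'I_n * 'I_n => (kl.1 < kl.2)%N)) //=.
  apply: eq_bigr => -[k l] /= ltkl; rewrite /W big_distrr /=.
  apply: eq_big => [s|s /andP[_ /eqP[<- <-]]//].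
  rewrite xpair_eqE; case: eqP => [->|]; case: eqP => [->|]; rewrite ?andbF //=.
  by rewrite ltkl.
pose g k l := X i k * M k i * (X i l * M l j).
(* The two terms of [W k l] become [g k l] and [g l k], so the sum over [k < l] is that of [g] over
   all off-diagonal pairs. *)
transitivity (\det X * \sum_k \sum_(l | l != k) g k l).
  rewrite (pair_big_dep xpredT (fun k l => l != k)) /= big_distrr /=.
  rewrite [RHS](bigID (fun kl : 'I_n * 'I_n => (kl.1 < kl.2)%N)) /=.
  rewrite [X in _ = _ + X](reindex_inj (h := fun kl : 'I_n * 'I_n => (kl.2, kl.1))) /=; last first.
    by move=> [? ?] [? ?] [-> ->].
  rewrite [X in _ = _ + X](eq_bigl (fun kl : 'I_n * 'I_n => (kl.2 != kl.1) && (kl.1 < kl.2)%N)).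
    rewrite -big_split /=; apply: eq_big => [[k l]|[k l] _] /=.
      by rewrite -(inj_eq val_inj) ltn_neqAle andbA (eq_sym (val l)) andbb.
    rewrite WE /g -mulrDr mulrCA; congr (_ * _).
    rewrite !mulrDr; congr (_ + _).
      by rewrite -!mulrA; congr (_ * _); rewrite mulrCA.
    rewrite [X in _ = X]mulrACA [X in X * _ = _]mulrC.
    by rewrite -!mulrA; congr (_ * _); rewrite mulrCA.
  move=> [k l] /=; rewrite -leqNgt leq_eqVlt (inj_eq val_inj) eq_sym.
  by case: (eqVneq l k).
congr (_ * _).
(* The full double sum has the factor [(X *m M) i j], which is 0; in characteristic 2 the
   off-diagonal part therefore equals the diagonal part. *)
have gE : \sum_k \sum_l g k l = 0.
  under eq_bigr do rewrite -big_distrr /=.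
  rewrite -big_distrl /=.
  have -> : \sum_l X i l * M l j = (X *m M) i j by rewrite mxE.
  by rewrite XM mxE (negPf nij) mulr0.
rewrite -[LHS]addr0 -[X in _ + X = _]gE -big_split; apply: eq_bigr => k _ /=.
rewrite [X in _ + X](bigD1 k) //= addrCA addrr2 addr0 /g expr2.
by rewrite -!mulrA; congr (_ * _); rewrite mulrCA.
Qed.

(** The row [a] combines the rows of [X] with coefficients [c = a M]. By linearity the term [i = j]
    gives back [X], and every other term has row [i] repeated as row [j]. *)
Lemma oddsum_set_row X M j (a : 'I_n -> K) (c := fun i => \sum_k a k * M k i) :
  X *m M = 1%:M ->
  oddsum (set_row X j a) =
    c j * oddsum X +
    \det X * \sum_(i | i != j) c i * \sum_k X i k ^+ 2 * M k i * M k j.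
Proof.
move=> XM; have MX := mulmx1C XM.
have aE : a =1 fun k => \sum_i c i * X i k.
  move=> k; transitivity (((\row_k a k) *m (M *m X)) 0 k); first by rewrite MX mulmx1 mxE.
  rewrite mulmxA mxE; apply: eq_bigr => i _; rewrite mxE; congr (_ * _).
  by apply: eq_bigr => l _; rewrite mxE.
have -> : set_row X j a = set_row X j (fun k => \sum_i c i * X i k).
  by apply/matrixP=> r k; rewrite !mxE; case: ifP => // _; rewrite -aE.
rewrite oddsum_set_row_sum (bigD1 j) //= set_row_id; congr (_ + _).
rewrite big_distrr /=; apply: eq_bigr => i nij.
by rewrite (oddsum_eq_rows nij XM) mulrCA.
Qed.

(** Column operations on [M]: divide column [j] by [c j], then subtract [c i] times it from each
    other column [i]. When [X M = 1] and [c = a M], they take [set_row X j a *m M], the identity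
    with row [j] replaced by [c], back to the identity. *)
Definition upd_inv M j (c : 'I_n -> K) : 'M[K]_n :=
  \matrix_(k, i) if i == j then M k j / c j else M k i - c i * (M k j / c j).

Lemma upd_invP X M j (a : 'I_n -> K) (c := fun i => \sum_k a k * M k i) :
  X *m M = 1%:M -> c j != 0 -> set_row X j a *m upd_inv M j c = 1%:M.
Proof.
move=> XM nc; rewrite mul_set_row; apply/matrixP=> r i; rewrite mxE.
have sumE (b : 'I_n -> K) : \sum_k b k * upd_inv M j c k i =
    if i == j then (\sum_k b k * M k j) / c j
    else \sum_k b k * M k i - c i * ((\sum_k b k * M k j) / c j).
  case: ifP => eij.
    by rewrite big_distrl; apply: eq_bigr => k _; rewrite mxE eij /= mulrA.
  rewrite (big_distrl _ _ (fun k => b k * M k j)) (big_distrr (c i)) -sumrB /=.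
  by apply: eq_bigr => k _; rewrite mxE eij mulrBr mulrCA !mulrA.
have XME r' i' : \sum_k X r' k * M k i' = (r' == i')%:R.
  by have /matrixP/(_ r' i') := XM; rewrite !mxE.
rewrite mxE; case: eqP => [->|/eqP nrj].
  rewrite sumE -/(c j) -/(c i) divff // mulr1 subrr.
  by rewrite ?mxE [j == i]eq_sym; case: (i == j).
rewrite sumE !XME (negPf nrj) mul0r mulr0 subr0.
by rewrite ?mxE; case: eqP => [->|//]; rewrite (negPf nrj).
Qed.

End Char2.

(** * Shifts, interpolation and cycle covers *)


Section PccPerm.
Variable n : nat.
Implicit Types s : 'S_n.

Definition graph_of s : {set 'I_n * 'I_n} := [set uv | uv.2 == s uv.1].

Lemma graph_of_inj : injective graph_of.
Proof.
move=> s t /setP est; apply/permP=> i.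
by have := est (i, s i); rewrite !inE eqxx => /esym/eqP.
Qed.

(** Out-degree one defines a map [f], and in-degree one makes it injective. *)
Lemma cycle_coverP (C : {set 'I_n * 'I_n}) :
  reflect (exists s, C = graph_of s) (cycle_cover C).
Proof.
apply: (iffP andP) => [[/forallP inC /forallP outC]|[s ->]]; last first.
  split; apply/forallP=> u; apply/cards1P.
    by exists (s^-1 u)%g; apply/setP=> v; rewrite !inE /= [v == _]eq_sym (can2_eq (permKV s) (permK s)).
  by exists (s u); apply/setP=> v; rewrite !inE.
have outP u : exists v, [set v | (u, v) \in C]%SET == [set v]%SET.
  by have /cards1P[v ->] := outC u; exists v.
pose f u := xchoose (outP u).
have fP u v : ((u, v) \in C) = (v == f u).
  by have /eqP/setP/(_ v) := xchooseP (outP u); rewrite !inE.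
have f_inj : injective f.
  move=> u v fuv; have /cards1P[w /setP Ew] := inC (f u).
  have := Ew u; have := Ew v; rewrite !inE !fP {1}fuv !eqxx.
  by move=> /esym/eqP-> /esym/eqP->.
exists (perm f_inj); apply/setP=> -[u v]; by rewrite !inE fP permE.
Qed.

Lemma connect_graph_of s u :
  [set v | connect [rel x y | (x, y) \in graph_of s] u v]%SET = porbit s u.
Proof.
apply/setP=> v; rewrite inE; apply/idP/porbitP.
  case/connectP=> p; elim: p u => [|w p IHp] u /=; first by move=> _ ->; exists 0%N; rewrite perm1.
  rewrite inE /= => /andP[/eqP-> sp] ev; have [i ->] := IHp _ sp ev.
  by exists i.+1; rewrite expgS permM.
case=> i ->; elim: i => [|i IHi]; first by rewrite perm1.
by apply: connect_trans IHi (connect1 _); rewrite /= inE /= expgSr permM.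
Qed.

Lemma num_cycles_graph_of s : num_cycles (graph_of s) = #|porbits s|.
Proof.
by rewrite /num_cycles /porbits; under eq_imset do rewrite connect_graph_of.
Qed.

Lemma pcc_oddsum (K : comNzRingType) (A : 'M[K]_n) : pcc (n%:Z - 1) A = oddsum A.
Proof.
have parity s : ((num_cycles (graph_of s))%:Z == n%:Z - 1 %[mod 2])%Z = odd_perm s.
  (* [odd_perm] is the parity of n plus the number of orbits; adding 1 to both sides removes the
     integer subtraction. *)
  rewrite num_cycles_graph_of /odd_perm card_ord -(eqz_modDr 1) subrK -PoszD addn1.
  by rewrite !modz_nat eqz_nat !modn2 /= ?modn2 /=; case: (odd n); case: (odd _).
rewrite /oddsum /pcc (eq_bigl (fun C => (C \in [set graph_of s | s : 'S_n]) &&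
    ((num_cycles C)%:Z == n%:Z - 1 %[mod 2])%Z)) => [|C]; last first.
  by congr (_ && _); apply/cycle_coverP/imsetP => -[s]; [|move=> _] => ->; exists s.
rewrite big_imset_cond => [|s t _ _]; last exact: graph_of_inj.
apply: eq_big => [s|s _]; first by rewrite /= parity.
rewrite (reindex_onto (fun i => (i, s i)) fst) /= => [|[u v]]; last by rewrite inE => /= /eqP->.
by apply: eq_bigl => i; rewrite inE !eqxx.
Qed.
End PccPerm.

(** * Row-by-row replacement, interpolation and bad shifts *)

Section Mixed.
Variables (K : fieldType) (n : nat).
Hypothesis K2 : (1 + 1 = 0 :> K).
Implicit Types (A M : 'M[K]_n).

Definition mixed A (j : nat) : 'M[K]_n := \matrix_(r, k) if (r < j)%N then A r k else (r == k)%:R.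

Lemma mixed0 A : mixed A 0 = 1%:M.
Proof. by apply/matrixP=> r k; rewrite !mxE. Qed.

Lemma mixedn A : mixed A n = A.
Proof. by apply/matrixP=> r k; rewrite !mxE ltn_ord. Qed.

Lemma mixedS A (j : 'I_n) : mixed A j.+1 = set_row (mixed A j) j (A j).
Proof.
apply/matrixP=> r k; rewrite !mxE ltnS leq_eqVlt (inj_eq val_inj).
by case: eqP => [->|].
Qed.

Section Step.
Variables (A M : 'M[K]_n) (j : 'I_n).
Let c i := \sum_k A j k * M k i.
Hypothesis XM : mixed A j *m M = 1%:M.

Lemma det_mixedS : \det (mixed A j.+1) = c j * \det (mixed A j).
Proof. by rewrite mixedS (det_set_row _ _ XM). Qed.

(** Compared with [oddsum_set_row], the terms with [i > j] drop out: row [i] of [mixed A j] is then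
    a unit row, so the inner sum is [M i i * M i j], and the inverse relation at [(i, j)] reads
    [M i j = 0]. *)
Lemma oddsum_mixedS : oddsum (mixed A j.+1) = c j * oddsum (mixed A j) +
  \det (mixed A j) * \sum_(i < n | (i < j)%N) c i * \sum_k A i k ^+ 2 * M k i * M k j.
Proof.
rewrite mixedS (oddsum_set_row K2 _ _ XM); congr (_ + _ * _).
rewrite big_mkcond [RHS]big_mkcond; apply: eq_bigr => i _.
have [lij|leji] := ltnP i j.
  rewrite -(inj_eq val_inj) ltn_eqF //; congr (_ * _).
  by apply: eq_bigr => k _; rewrite mxE lij.
case: eqVneq => //= nij; rewrite -/(c i) big1 ?mulr0 // => k _.
rewrite mxE ltnNge leji /=; case: eqVneq => [<-|]; last by rewrite expr0n !mul0r.
have /matrixP/(_ i j) := XM; rewrite !mxE (negPf nij) (bigD1 i) //=.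
rewrite mxE ltnNge leji /= eqxx mul1r big1 ?addr0 => [->|l nli]; first by rewrite mulr0.
by rewrite mxE ltnNge leji /= eq_sym (negPf nli) mul0r.
Qed.

Lemma mixedS_inv : c j != 0 -> mixed A j.+1 *m upd_inv M j c = 1%:M.
Proof. by move=> nc; rewrite mixedS; apply: upd_invP. Qed.

End Step.

Definition oddpoly A : {poly K} := oddsum (map_mx polyC A + 'X%:M).

Lemma horner_oddpoly A x : (oddpoly A).[x] = oddsum (A + x%:M).
Proof.
rewrite /oddpoly /oddsum horner_sum; apply: eq_bigr => s _.
rewrite horner_prod; apply: eq_bigr => i _.
by rewrite !mxE hornerD hornerC hornerMn hornerX.
Qed.

Lemma size_oddpoly A : (size (oddpoly A) <= n)%N.
Proof.
apply: (leq_trans (size_sum _ _ _)); apply/bigmax_leqP => s odd_s.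
have [i nsi] := odd_perm_moves odd_s.
rewrite (bigD1 i) //= !mxE eq_sym (negPf nsi) mulr0n addr0 mul_polyC.
apply: (leq_trans (size_scale_leq _ _)).
have : (size (\prod_(m | m != i) (map_mx polyC A + 'X%:M)%R m (s m))%R <= #|[pred m | m != i]|.+1)%N.
  rewrite -sum1_card; elim/big_rec2: _ => [|m y1 y2 _ IH]; first by rewrite size_poly1.
  apply: (leq_trans (size_mul_leq _ _)).
  have le2 : (size ((map_mx polyC A + 'X%:M)%R m (s m)) <= 2)%N.
    rewrite !mxE (leq_trans (size_polyD _ _)) // geq_max (leq_trans (size_polyC_leq1 _)) //.
    by case: (m == s m); rewrite ?mulr1n ?mulr0n ?size_polyX ?size_poly0.
  by rewrite -subn1 leq_subLR (leq_trans (leq_add le2 IH)).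
by rewrite (eq_card (_ : _ =i predC1 i)) // cardC1 card_ord prednK // (leq_ltn_trans _ (ltn_ord i)).
Qed.

(** The Lagrange form [q] has size at most n and agrees with [p] at n distinct points. Its factors
    are written [x t - X], so that their value at 0 is [x t] itself. *)
Lemma lagrange0 (p : {poly K}) (x : 'I_n -> K) : injective x -> (size p <= n)%N ->
  p.[0] = \sum_s p.[x s] * \prod_(t | t != s) (x t / (x t - x s)).
Proof.
move=> x_inj sz_p.
pose l s : {poly K} := \prod_(t | t != s) ((x t - x s)^-1 *: ((x t)%:P - 'X)).
have lE s y : (l s).[y] = \prod_(t | t != s) ((x t - y) / (x t - x s)).
  by rewrite horner_prod; apply: eq_bigr => t _; rewrite !hornerE mulrC.
have sz_l s : (size (l s) <= n)%N.
  have : (size (l s) <= #|[pred m | m != s]|.+1)%N.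
    rewrite /l -sum1_card; elim/big_rec2: _ => [|m y1 y2 _ IH]; first by rewrite size_poly1.
    apply: (leq_trans (size_mul_leq _ _)).
    have le2 : (size ((x m - x s)^-1 *: ((x m)%:P - 'X))%R <= 2)%N.
      apply: (leq_trans (size_scale_leq _ _)).
      by rewrite -size_polyN opprB size_XsubC.
    by rewrite -subn1 leq_subLR (leq_trans (leq_add le2 IH)).
  by rewrite (eq_card (_ : _ =i predC1 s)) // cardC1 card_ord prednK // (leq_ltn_trans _ (ltn_ord s)).
pose q := \sum_s p.[x s] *: l s.
suff pq : p = q.
  rewrite [in LHS]pq horner_sum; apply: eq_bigr => s _; rewrite hornerZ lE; congr (_ * _).
  by apply: eq_bigr => t _; rewrite subr0.
apply/eqP; rewrite -subr_eq0; apply: contraT => npq.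
have roots : all (root (p - q)) (codom x).
  apply/allP=> _ /codomP[s ->]; rewrite rootE hornerD hornerN horner_sum (bigD1 s) //=.
  rewrite hornerZ lE big1 => [|t nts]; last by rewrite divff // subr_eq0 (inj_eq x_inj).
  rewrite mulr1 big1 ?addr0 ?subrr // => t nts.
  by rewrite hornerZ lE (bigD1 s) 1?eq_sym //= subrr mul0r mul0r mulr0.
have := max_poly_roots npq roots; rewrite codomE map_inj_uniq // enum_uniq size_map size_enum_ord.
move=> /(_ isT); rewrite ltnNge (leq_trans (size_polyD _ _)) // geq_max sz_p size_polyN.
by apply: (leq_trans (size_sum _ _ _)); apply/bigmax_leqP => s _; rewrite (leq_trans (size_scale_leq _ _)).
Qed.

(** Equivalently, all leading principal minors of A + x I are nonzero, as the lower rows of [mixed]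
    are unit rows. *)
Definition good_shift A x : bool := [forall j : 'I_n, \det (mixed (A + x%:M) j.+1) != 0].

(** At [x] the characteristic matrix has rows of A + x I on top and x times unit rows below, so it
    is a diagonal matrix times the singular [mixed]. Padding with zero rows keeps the polynomial
    monic of degree n. *)
Lemma bad_shift_root A x : ~~ good_shift A x ->
  exists j : 'I_n, root (char_poly (\matrix_(r, k) if (r <= j)%N then - A r k else 0)) x.
Proof.
rewrite negb_forall => /existsP[j]; rewrite negbK => /eqP det0.
exists j; rewrite rootE /char_poly -horner_evalE -det_map_mx.
rewrite (_ : map_mx _ _ = diag_mx (\row_r if (r <= j)%N then 1 else x) *m mixed (A + x%:M) j.+1).
  by rewrite det_mulmx det0 mulr0.
apply/matrixP=> r k; rewrite mul_diag_mx !mxE ltnS /= /horner_eval.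
rewrite hornerD hornerN hornerC hornerMn hornerX; case: leqP => _; first by rewrite mul1r opprK addrC.
by rewrite oppr0 addr0 mulr_natr.
Qed.

End Mixed.

Lemma card_bad_shift (F : finFieldType) n (A : 'M[F]_n) :
  (#|[pred x | ~~ good_shift A x]| <= n * n)%N.
Proof.
pose B (j : 'I_n) := \matrix_(r, k) if (r <= j)%N then - A r k else 0.
pose R (j : 'I_n) := [set x | root (char_poly (B j)) x].
have cR j : (#|R j| <= n)%N.
  have np : char_poly (B j) != 0 by rewrite monic_neq0 ?char_poly_monic.
  have := max_poly_roots np (rs := enum (R j)).
  rewrite size_char_poly ltnS -cardE; apply; last exact: enum_uniq.
  by apply/allP=> x; rewrite mem_enum inE.
have sub : [pred x | ~~ good_shift A x] \subset \bigcup_j R j.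
  by apply/fintype.subsetP=> x /bad_shift_root[j rt]; apply/bigcupP; exists j; rewrite ?inE.
apply: (leq_trans (subset_leq_card sub)).
apply: (@leq_trans (\sum_j #|R j|)); last first.
  have := leq_sum (index_enum _) (fun (j : 'I_n) (_ : xpredT j) => cR j).
  by rewrite sum_nat_const card_ord.
elim/big_rec2: _ => [|j m C _ IH]; first by rewrite cards0.
by rewrite (leq_trans (leq_card_setU _ _)) // leq_add2l.
Qed.

(** * The exponent of matrix multiplication is at least 2 *)


Lemma nth_flatten_const (T : Type) (x0 : T) n (ss : seq (seq T)) r c :
  all (fun s => size s == n) ss -> (r < size ss)%N -> (c < n)%N ->
  nth x0 (flatten ss) (r * n + c) = nth x0 (nth [::] ss r) c.
Proof.
elim: ss r => [|s ss IH] [|r] //= /andP[/eqP sz_s all_ss] ltr ltc.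
  by rewrite mul0n add0n nth_cat sz_s ltc.
rewrite nth_cat sz_s mulSn -addnA ltnNge leq_addr /= addKn; exact: IH.
Qed.

Lemma nth_entries (T : Type) (x0 : T) n (A : 'M[T]_n) (i j : 'I_n) :
  nth x0 (entries A) (i * n + j) = A i j.
Proof.
have sz : all (fun s => size s == n) [seq [seq A k l | l <- enum 'I_n] | k <- enum 'I_n].
  by rewrite all_map; apply/allP=> k _ /=; rewrite size_map size_enum_ord.
have lt_enum (k : 'I_n) : (k < size (enum 'I_n))%N by rewrite size_enum_ord.
have lt_i : (i < size [seq [seq A k l | l <- enum 'I_n] | k <- enum 'I_n])%N.
  by rewrite size_map.
rewrite /entries (nth_flatten_const x0 sz lt_i (ltn_ord j)).
by rewrite (nth_map i _ _ (lt_enum i)) (nth_map j _ _ (lt_enum j)) !nth_ord_enum.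
Qed.

Lemma size_entries (T : Type) n (A : 'M[T]_n) : size (entries A) = (n * n)%N.
Proof. by rewrite size_allpairs size_enum_ord. Qed.

Section Slp.
Variable K : comNzRingType.
Implicit Types (p : seq (slp_instr K)) (ab : seq (nat * nat)).

Section Run.
Variable S : comAlgType K.
Implicit Types vs : seq S.
Local Notation run := (foldl (@slp_step K S)).

Lemma size_run vs p : size (run vs p) = (size vs + size p)%N.
Proof. by elim: p vs => [|i p IH] vs /=; rewrite ?addn0 // IH size_rcons addSnnS. Qed.

Lemma nth_run vs p i : (i < size vs)%N -> (run vs p)`_i = vs`_i.
Proof.
elim: p vs => [//|q p IH] vs lti /=.
by rewrite IH ?size_rcons ?leqW // nth_rcons lti.
Qed.
End Run.

(** Cell [acc] is the last one and holds the running sum; each pair appends its product at [acc.+1]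
    and the new sum at [acc.+2]. *)
Fixpoint dot_slp acc ab : seq (slp_instr K) :=
  if ab is (a, b) :: ab' then SMul K a b :: SAdd K acc acc.+1 :: dot_slp acc.+2 ab'
  else [::].

Lemma size_dot_slp acc ab : size (dot_slp acc ab) = (2 * size ab)%N.
Proof. by elim: ab acc => [|[a b] ab IH] acc //=; rewrite IH; lia. Qed.

Lemma dot_slpP (S : comAlgType K) (vs : seq S) acc ab m :
  size vs = acc.+1 -> (m <= acc.+1)%N ->
  all (fun u => (u.1 < m)%N && (u.2 < m)%N) ab ->
  (foldl (@slp_step K S) vs (dot_slp acc ab))`_(acc + 2 * size ab) =
    vs`_acc + \sum_(u <- ab) vs`_u.1 * vs`_u.2.
Proof.
elim: ab vs acc => [|[a b] ab IH] vs acc sz_vs lem /=.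
  by rewrite muln0 addn0 big_nil addr0.
case/andP=> /andP[lta ltb] all_ab.
have -> : (acc + 2 * (size ab).+1 = acc.+2 + 2 * size ab)%N by lia.
rewrite IH ?size_rcons ?sz_vs //; last by lia.
have ltv i : (i < m)%N -> (i < size vs)%N by lia.
rewrite nth_rcons size_rcons sz_vs ltnn eqxx !nth_rcons sz_vs !ltnSn ltnn eqxx big_cons addrA.
congr (_ + _); rewrite big_seq [RHS]big_seq; apply: eq_bigr => -[c d] /= cd_ab.
have /andP[/= ltc ltd] := allP all_ab _ cd_ab.
by rewrite !nth_rcons !size_rcons sz_vs !(leq_trans ltc, leq_trans ltd) // leqW.
Qed.

(** [N] is the number of cells already filled. Each dot product starts from a fresh zero cell and
    fills one cell plus two per pair, the last holding its value. *)
Fixpoint dots_slp N (L : seq (seq (nat * nat))) : seq (slp_instr K) :=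
  if L is ab :: L' then SConst 0 :: dot_slp N ab ++ dots_slp (N + (2 * size ab).+1)%N L'
  else [::].

Lemma size_dots_slp n N L : all (fun ab => size ab == n) L ->
  size (dots_slp N L) = (size L * (2 * n).+1)%N.
Proof.
elim: L N => [|ab L IH] N //= /andP[/eqP sz_ab all_L].
by rewrite size_cat size_dot_slp IH // sz_ab mulSn.
Qed.

Lemma dots_slpP (S : comAlgType K) (vs : seq S) n L m b :
  (m <= size vs)%N -> all (fun ab => size ab == n) L ->
  all (all (fun u => (u.1 < m)%N && (u.2 < m)%N)) L -> (b < size L)%N ->
  (foldl (@slp_step K S) vs (dots_slp (size vs) L))`_(size vs + b * (2 * n).+1 + 2 * n) =
    \sum_(u <- nth [::] L b) vs`_u.1 * vs`_u.2.
Proof.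
elim: L vs b => [|ab L IH] vs b lem //= /andP[/eqP sz_ab szL] /andP[lt_ab ltL] ltb.
rewrite foldl_cat; set vs1 := slp_step vs _.
have sz1 : size vs1 = (size vs).+1 by rewrite size_rcons.
set vs2 := foldl _ vs1 _.
have sz2 : size vs2 = (size vs + (2 * size ab).+1)%N.
  by rewrite size_run sz1 size_dot_slp addSnnS.
have stable v : (v < m)%N -> vs2`_v = vs`_v.
  move=> ltv; have ltvs := leq_trans ltv lem.
  by rewrite nth_run ?sz1 ?leqW // nth_rcons ltvs.
case: b ltb => [_|b ltb].
  rewrite mul0n addn0 nth_run ?sz2 ?sz_ab; last by lia.
  rewrite -sz_ab (dot_slpP (m := m)) //; last by lia.
  rewrite nth_rcons ltnn eqxx scale0r add0r /= big_seq [RHS]big_seq.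
  apply: eq_bigr => u u_ab; have /andP[lt1 lt2] := allP lt_ab _ u_ab.
  by rewrite !nth_rcons !(leq_trans _ lem).
have -> : (size vs + b.+1 * (2 * n).+1 + 2 * n = size vs2 + b * (2 * n).+1 + 2 * n)%N.
  by rewrite sz2 sz_ab; lia.
rewrite -sz2 IH ?sz2 //; last by lia.
rewrite big_seq [RHS]big_seq; apply: eq_bigr => u u_ab.
have /allP/(_ u u_ab)/andP[lt1 lt2] := allP ltL _ (mem_nth [::] (ltb : (b < size L)%N)).
by rewrite !stable.
Qed.

Lemma slp_multiplies_naive n :
  exists2 p : seq (slp_instr K), slp_multiplies n p & size p = (n * n * (2 * n).+1)%N.
Proof.
(* Index [b] stands for the entry in row [b %/ n] and column [b %% n]; the entries of the second
   factor start at cell n^2. *)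
pose L := mkseq (fun b => mkseq (fun k => (b %/ n * n + k, n * n + (k * n + b %% n))%N) n) (n * n).
have szL : all (fun ab => size ab == n) L.
  by apply/allP=> ab /mapP[b _ ->]; rewrite size_mkseq.
exists (dots_slp (n * n + n * n) L); last by rewrite (size_dots_slp _ szL) size_mkseq.
exists (fun i j => n * n + n * n + (i * n + j) * (2 * n).+1 + 2 * n)%N => S A B i j.
have szE : size (entries A ++ entries B) = (n * n + n * n)%N by rewrite size_cat !size_entries.
have ltij (u v : 'I_n) : (u * n + v < n * n)%N.
  by have := ltn_ord u; have := ltn_ord v; nia.
rewrite -szE (dots_slpP (m := n * n + n * n)) ?szE ?size_mkseq //; last first.
  apply/allP=> ab /mapP[b]; rewrite mem_iota /= add0n => ltb ->.
  apply/allP=> u /mapP[k]; rewrite mem_iota /= add0n => ltk -> /=.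
  have n0 : (0 < n)%N by lia.
  have ltd : (b %/ n < n)%N by rewrite ltn_divLR.
  have := ltij (Ordinal ltd) (Ordinal ltk).
  have := ltij (Ordinal ltk) (Ordinal (ltn_pmod b n0)).
  rewrite /=; lia.
rewrite nth_mkseq //= mxE /mkseq big_map -[n in iota _ n]subn0 big_mkord.
apply: eq_bigr => k _; have n0 : (0 < n)%N by apply: leq_trans (ltn_ord i).
rewrite divnMDl // divn_small // addn0 modnMDl modn_small //.
rewrite nth_cat size_entries ltij nth_entries nth_cat size_entries.
by rewrite ltnNge leq_addr /= addKn nth_entries.
Qed.

(* Column 0 of A holds X^(n i + n^2) and row 0 of B holds X^(j + n^2): the n^2
   entries of A B are distinct, and none is an input or the junk value 0 of an
   out-of-range cell. *)
Lemma slp_multiplies_size n (p : seq (slp_instr K)) :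
  slp_multiplies n p -> (n * n <= size p)%N.
Proof.
case: n => [//|n] [out outP].
pose A : 'M[{poly K}]_n.+1 := \matrix_(i, k) if k == 0 then 'X^(i * n.+1 + n.+1 * n.+1) else 0.
pose B : 'M[{poly K}]_n.+1 := \matrix_(k, j) if k == 0 then 'X^(j + n.+1 * n.+1) else 0.
have AB i j : (A *m B) i j = 'X^(i * n.+1 + j + 2 * (n.+1 * n.+1)).
  rewrite mxE (bigD1 0) //= !mxE eqxx -exprD big1 ?addr0 => [|k nk].
    by congr ('X^_); lia.
  by rewrite !mxE (negPf nk) mul0r.
have ltij (u v : 'I_n.+1) : (u * n.+1 + v < n.+1 * n.+1)%N.
  by have := ltn_ord u; have := ltn_ord v; nia.
have Xinj a b : 'X^a = 'X^b :> {poly K} -> a = b.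
  by move=> /(congr1 (size \o val)); rewrite /= !size_polyXn => -[].
pose vs := foldl (@slp_step K {poly K}) (entries A ++ entries B) p.
have outE i j : vs`_(out i j) = 'X^(i * n.+1 + j + 2 * (n.+1 * n.+1)).
  by rewrite /vs (outP {poly K} A B) AB.
have sz_vs : size vs = (2 * (n.+1 * n.+1) + size p)%N.
  by rewrite size_run size_cat !size_entries; lia.
have lt_out i j : (out i j < size vs)%N.
  rewrite ltnNge; apply/negP=> le; have := outE i j; rewrite nth_default //.
  by move/esym/eqP; rewrite -size_poly_eq0 size_polyXn.
have in_entry q : (q < 2 * (n.+1 * n.+1))%N -> vs`_q = 0 \/
   exists2 e, vs`_q = 'X^e & (e < 2 * (n.+1 * n.+1))%N.
  move=> ltq; rewrite nth_run; last by rewrite size_cat !size_entries; lia.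
  have : (entries A ++ entries B)`_q \in entries A ++ entries B.
    by apply: mem_nth; rewrite size_cat !size_entries; lia.
  rewrite mem_cat => /orP[] /allpairsP[[i j] [_ _ ->]] /=; rewrite mxE; case: ifP => _; (try by left);
    right; eexists; try reflexivity; have := ltij i j; have := ltn_ord j; nia.
have ge_out i j : (2 * (n.+1 * n.+1) <= out i j)%N.
  rewrite leqNgt; apply/negP => /in_entry[|[e]]; rewrite outE.
    by move/eqP; rewrite -size_poly_eq0 size_polyXn.
  by move/Xinj; lia.
have lt_rank ij : (out ij.1 ij.2 - 2 * (n.+1 * n.+1) < size p)%N.
  by have := lt_out ij.1 ij.2; have := ge_out ij.1 ij.2; lia.
have rank_inj : injective (fun ij => Ordinal (lt_rank ij)).
  move=> [i j] [i' j'] /(congr1 val) /= E.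
  have : out i j = out i' j' by have := ge_out i j; have := ge_out i' j'; lia.
  move/(congr1 (fun q => vs`_q)); rewrite !outE => /Xinj/eqP.
  rewrite eqn_add2r => /eqP E2.
  have Ej : j = j' :> nat.
    by have := congr1 (modn^~ n.+1) E2; rewrite !modnMDl !modn_small.
  have Ei : i = i' :> nat by have := ltn_ord i; nia.
  by rewrite (val_inj Ei) (val_inj Ej).
by have := leq_card _ rank_inj; rewrite card_prod !card_ord.
Qed.
End Slp.

Lemma omega_ge2 (R : realType) : 2 <= omega R.
Proof.
apply: lb_le_inf.
  (* The infimum needs a nonempty set: the naive program has n^2 (2n + 1) <= 3 n^3 instructions, so
     3 is an exponent with constant 3. *)
  exists 3, 3 => n n0; have [p pP sz_p] := slp_multiplies_naive 'F_2 n.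
  exists p => //; rewrite powR_mulrn ?ler0n // sz_p -natrX -natrM ler_nat; nia.
move=> t [c cP]; rewrite leNgt; apply/negP => ltt2.
have bound n : (0 < n)%N -> n%:R ^+ 2 <= c * n%:R `^ t.
  move=> n0; have [p /slp_multiplies_size le_p] := cP n n0.
  by apply: le_trans; rewrite -natrX ler_nat -mulnn.
have c0 : 0 < c.
  by have := bound 1%N isT; rewrite expr1n powR1 mulr1; apply: lt_le_trans.
(* Logarithms of the bound at n = 2^m: a positive multiple of m would stay below a constant. *)
have lnb m : (2 - t) * ln 2 * m%:R <= ln c.
  have p2 : 0 < (2 ^ m)%:R :> R by rewrite ltr0n expn_gt0.
  have := bound (2 ^ m)%N; rewrite expn_gt0 => /(_ isT).
  rewrite -ler_ln ?posrE ?mulr_gt0 ?powR_gt0 ?exprn_gt0 //.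
  rewrite lnM ?posrE ?powR_gt0 // ln_powR lnXn // natrX lnXn //.
  rewrite -[ln 2 *+ m]mulr_natr -mulr_natr; lra.
have l2 : 0 < (2 - t) * ln 2 :> R by rewrite mulr_gt0 ?subr_gt0 // ln_gt0 // ltr1n.
have := lnb (Num.truncn (ln c / ((2 - t) * ln 2))).+1.
rewrite leNgt => /negP; apply; rewrite mulrC -ltr_pdivrMr //.
exact: truncnS_gt.
Qed.

(** * Loop programs and their compilation *)


(* Loop programs over field scalars and four n x n arrays. Integers occur only
   as an environment: entry 0 is n and entry l > 0 the counter of the l-th
   enclosing loop. [Load x a r c] reads array a at the counters r and c. *)
Inductive prog :=
| PConst of nat & bool
| POp of fop & nat & nat & nat
| PLoad of nat & nat & nat & nat
| PStore of nat & nat & nat & nat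
| PSample of nat
| PSeq of prog & prog
| PIfNonzero of nat & prog
| PFor of nat & prog.

Record fstate (F : Type) := FState {
  sc : nat -> F;
  ar : nat -> nat -> nat -> F;
  tp : seq F }.

Definition set_sc (F : Type) (m : fstate F) x v : fstate F :=
  FState [eta sc m with x |-> v] (ar m) (tp m).

Definition set_ar (F : Type) (m : fstate F) a r c v : fstate F :=
  FState (sc m) (fun a' => if a' == a then
                fun r' c' => if (r' == r) && (c' == c) then v else ar m a r' c'
              else ar m a') (tp m).

(** Sampling from an exhausted tape yields 0, which keeps the semantics total; [compileP] assumes a
    long enough tape. *)
Fixpoint sem (F : fieldType) (e : seq nat) (p : prog) (m : fstate F) : fstate F :=
  match p with
  | PConst x b => set_sc m x b%:R
  | POp o x y z => set_sc m x (fop_fun o (sc m y) (sc m z))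
  | PLoad x a r c => set_sc m x (ar m a (nth 0%N e r) (nth 0%N e c))
  | PStore a r c x => set_ar m a (nth 0%N e r) (nth 0%N e c) (sc m x)
  | PSample x => FState [eta sc m with x |-> head 0 (tp m)] (ar m) (behead (tp m))
  | PSeq p q => sem e q (sem e p m)
  | PIfNonzero x p => if sc m x == 0 then m else sem e p m
  | PFor b p => foldl (fun m v => sem (rcons e v) p m) m (iota 0 (nth 0%N e b))
  end.

Fixpoint block (l : seq instr) : cmd :=
  if l is i :: l' then Seq (Basic i) (block l') else Skip.

(* Integer cells: 2 holds the base address n^2 + 16 of the arrays, 3 the
   constant 1, 4 is scratch and l + 8 holds entry l of the environment. *)
Definition lv (l : nat) : nat := l.+4.+4.

Definition address (a r c : nat) : seq instr :=
  [:: Iset 4 a; Iop Imul 4 4 (lv 0); Iop Iadd 4 4 (lv r); Iop Imul 4 4 (lv 0);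
      Iop Iadd 4 4 (lv c); Iop Iadd 4 4 2].

(** [k] is the length of the environment, so a loop met here keeps its counter in cell [lv k]. *)
Fixpoint compile (k : nat) (p : prog) : cmd :=
  match p with
  | PConst x b => Basic (Fset x b)
  | POp o x y z => Basic (Fop o x y z)
  | PLoad x a r c => Seq (block (address a r c)) (Basic (Fload x 4))
  | PStore a r c x => Seq (block (address a r c)) (Basic (Fstore 4 x))
  | PSample x => Basic (Fsample x)
  | PSeq p q => Seq (compile k p) (compile k q)
  | PIfNonzero x p => If (Tfzero x) Skip (compile k p)
  | PFor b p =>
      Seq (Basic (Iset (lv k) 0))
        (While (Tlt (lv k) (lv b))
           (Seq (compile k.+1 p) (Basic (Iop Iadd (lv k) (lv k) 3))))
  end.

(** Array indices exclude entry 0 of the environment, whose value n is out of range. Sixteen scalars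
    and the nesting bound keep every cell number in the code below 64. *)
Fixpoint wf (k : nat) (p : prog) : bool :=
  match p with
  | PConst x _ => (x < 16)%N
  | POp _ x y z => [&& x < 16, y < 16 & z < 16]%N
  | PLoad x a r c => [&& x < 16, a < 4, 0 < r < k & 0 < c < k]%N
  | PStore a r c x => [&& x < 16, a < 4, 0 < r < k & 0 < c < k]%N
  | PSample x => (x < 16)%N
  | PSeq p q => wf k p && wf k q
  | PIfNonzero x p => (x < 16)%N && wf k p
  | PFor b p => [&& b < k, k < 8 & wf k.+1 p]%N
  end.

Fixpoint depth (p : prog) : nat :=
  match p with
  | PSeq p q => maxn (depth p) (depth q)
  | PIfNonzero _ p => depth p
  | PFor _ p => (depth p).+1
  | _ => 0
  end.

(** Counted in [unit_cost]: an array access is six address instructions, the end of their block and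
    the access itself. A loop adds a test and an increment per pass, and once the initialisation and
    the last test. *)
Fixpoint weight (p : prog) : nat :=
  match p with
  | PLoad _ _ _ _ | PStore _ _ _ _ => 8
  | PSeq p q => weight p + weight q
  | PIfNonzero _ p => weight p + 2
  | PFor _ p => weight p + 4
  | _ => 1
  end.

Definition ops n p : nat := (weight p * n ^ depth p)%N.

Section Compile.
Variables (F : fieldType) (n w : nat).
Hypothesis n0 : (0 < n)%N.

(** Bounds every address: array cells lie below n^2 + 16 + 4 n^2, at most 21 n^2 for n > 0. *)
Definition top : nat := (22 * n ^ 2)%N.
(** 18 covers three cell numbers of at most 6 bits, the next two terms an addition and a schoolbook
    multiplication, and [w] a field operation. *)
Definition unit_cost : nat := (18 + 2 * bitlen top + bitlen top * bitlen top + w)%N.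

Lemma bitlen_le a b : (a <= b)%N -> (bitlen a <= bitlen b)%N.
Proof. by move=> leab; rewrite ltnS leq_trunc_log. Qed.

Lemma bitlen_cell x : (x < 64)%N -> (bitlen x <= 6)%N.
Proof. by move=> ltx; apply: (@leq_trans (bitlen 63)) => //; exact: bitlen_le. Qed.

Definition cell_ok (s : state F) x := (x < 64)%N /\ (imem s x <= top)%N.

Lemma iop_unit s o x y z : (x < 64)%N -> cell_ok s y -> cell_ok s z ->
  (instr_cost w (Iop o x y z) s <= unit_cost)%N.
Proof.
move=> /bitlen_cell bx [/bitlen_cell b_y /bitlen_le ly] [/bitlen_cell bz /bitlen_le lz].
have := leq_mul ly lz; rewrite /unit_cost /=; case: o => /=; lia.
Qed.

Inductive block_run : seq instr -> state F -> state F -> Prop :=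
| BlockNil s : block_run [::] s s
| BlockCons i l s s1 s2 of effect i s = Some s1 & (instr_cost w i s <= unit_cost)%N
    & block_run l s1 s2 : block_run (i :: l) s s2.

Lemma block_runP l s s' : block_run l s s' ->
  exists2 t, exec w (block l) s t s' & (t <= (size l).+1 * unit_cost)%N.
Proof.
elim=> {l s s'} [s|i l s s1 s2 eff le_i _ [t ex le_t]].
  by exists 1%N; [exact: ExecSkip | rewrite /unit_cost /=; lia].
exists (instr_cost w i s + t)%N; first by apply: ExecSeq ex; apply: ExecBasic.
by rewrite [size _]/= mulSn leq_add.
Qed.

Definition env_ok (e : seq nat) : Prop :=
  [/\ (0 < size e)%N, nth 0%N e 0 = n
    & forall l, (0 < l < size e)%N -> (nth 0%N e l < n)%N].

(** Above both the n^2 input cells and the 16 scalar cells, so the copy overwrites no unread input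
    and the arrays avoid the scalars. *)
Definition base : nat := (n * n + 16)%N.

Record rep (e : seq nat) (s : state F) (m : fstate F) : Prop := Rep {
  rep_base : imem s 2 = base;
  rep_one : imem s 3 = 1%N;
  rep_env l : (l < size e)%N -> imem s (lv l) = nth 0%N e l;
  rep_sc x : (x < 16)%N -> fmem s x = sc m x;
  rep_ar a r c : (a < 4)%N -> (r < n)%N -> (c < n)%N ->
    fmem s (base + ((a * n + r) * n + c))%N = ar m a r c;
  rep_tp : tape s = tp m }.

Lemma env_le e l : env_ok e -> (l < size e)%N -> (nth 0%N e l <= n)%N.
Proof.
case=> _ e0 ltn_e; case: l => [|l] ltl; first by rewrite e0.
by apply/ltnW/ltn_e.
Qed.

Lemma address_run e s m a r c : env_ok e -> rep e s m -> (size e <= 9)%N ->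
  (a < 4)%N -> (0 < r < size e)%N -> (0 < c < size e)%N ->
  let q := (base + ((a * n + nth 0%N e r) * n + nth 0%N e c))%N in
  exists s', [/\ block_run (address a r c) s s', imem s' 4 = q,
    forall x, x != 4%N -> imem s' x = imem s x, fmem s' = fmem s & tape s' = tape s].
Proof.
move=> eok rs sz_e lta /andP[r0 ltr] /andP[c0 ltc] q.
have [e_gt0 e0 ltn_e] := eok.
have En : imem s (lv 0) = n by rewrite (rep_env rs) // e0.
have Er : imem s (lv r) = nth 0%N e r by rewrite (rep_env rs).
have Ec : imem s (lv c) = nth 0%N e c by rewrite (rep_env rs).
have ltrn : (nth 0%N e r < n)%N by apply: ltn_e; rewrite r0.
have ltcn : (nth 0%N e c < n)%N by apply: ltn_e; rewrite c0.
have le1 : (a * n <= 3 * n)%N by rewrite leq_mul2r -ltnS lta orbT.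
have le2 : ((a * n + nth 0%N e r) * n <= 4 * (n * n))%N by nia.
have Eb := rep_base rs; rewrite /base in Eb.
have lt_lv l : (l < size e)%N -> (lv l < 64)%N by rewrite /lv; lia.
rewrite /lv in En Er Ec lt_lv; pose h := nth 0%N e; rewrite -/(h _) in Er Ec le2 ltrn ltcn.
eexists; split.
{ do ![eapply BlockCons; [reflexivity | | ]]; try exact: BlockNil.
  + have := bitlen_cell (isT : (4 < 64)%N); have : (a < 64)%N by lia.
    by move/bitlen_cell; rewrite /unit_cost /=; lia.
  all: apply: iop_unit => //; split=> //=; rewrite ?lt_lv ?En ?Er ?Ec ?Eb //; rewrite /top; nia. }
- by rewrite /= En Er Ec Eb /q /base -!/(h _); lia.
- by move=> x /negPf nx; rewrite /= !nx.
- by [].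
- by [].
Qed.

Lemma rep_set_sc e s m x v : (x < 16)%N -> rep e s m ->
  rep e (set_fcell s x v) (set_sc m x v).
Proof.
move=> ltx [b o en Es Ea Et]; split=> //= [y lty|a r c lta ltr ltc]; first by rewrite Es.
by rewrite -Ea //; case: eqP => // E; move: E; rewrite /base; lia.
Qed.

Lemma div_addr q1 q2 r1 r2 : (r1 < n)%N -> (r2 < n)%N ->
  (q1 * n + r1 == q2 * n + r2)%N = (q1 == q2) && (r1 == r2).
Proof.
move=> lt1 lt2; apply/eqP/andP => [E|[/eqP-> /eqP->]//].
have := congr1 (divn^~ n) E; have := congr1 (modn^~ n) E.
by rewrite !modnMDl !divnMDl // !modn_small // !divn_small // !addn0 => -> ->.
Qed.

Lemma rep_set_ar e s m a r c v : (a < 4)%N -> (r < n)%N -> (c < n)%N -> rep e s m ->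
  rep e (set_fcell s (base + ((a * n + r) * n + c))%N v) (set_ar m a r c v).
Proof.
move=> lta ltr ltc [b o en Es Ea Et]; split=> //= [y lty|a' r' c' lta' ltr' ltc'].
  by rewrite Es //; case: eqP => // E; move: E; rewrite /base; lia.
rewrite eqn_add2l !div_addr // Ea //.
by case: (a' =P a) => [->|].
Qed.

Lemma rep_imem e s s' m : rep e s m ->
  (forall x, x != 4%N -> imem s' x = imem s x) -> fmem s' = fmem s -> tape s' = tape s ->
  rep e s' m.
Proof.
move=> [b o en Es Ea Et] Ei Ef Etp; split; rewrite ?Ef ?Etp ?Ei //.
by move=> l ltl; rewrite Ei ?en.
Qed.

Lemma rep_rcons e s m v : rep (rcons e v) s m -> rep e s m.
Proof.
case=> b o en Es Ea Et; split=> // l ltl.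
by rewrite en ?nth_rcons ?size_rcons ?ltl // ltnW.
Qed.

Lemma rep_push e s m v : rep e s m -> imem s (lv (size e)) = v -> rep (rcons e v) s m.
Proof.
case=> b o en Es Ea Et Ev; split=> // l; rewrite size_rcons ltnS nth_rcons => lel.
by case: ltngtP lel => // [ltl _|-> _]; first exact: en.
Qed.

Lemma rep_counter e s m v : rep e s m -> rep e (set_icell s (lv (size e)) v) m.
Proof.
case=> b o en Es Ea Et; split=> //= l ltl.
by rewrite /lv !eqSS ltn_eqF // en.
Qed.

Lemma env_ok_rcons e v : env_ok e -> (v < n)%N -> env_ok (rcons e v).
Proof.
case=> e_gt0 e0 ltn_e ltv; split; rewrite ?size_rcons ?nth_rcons ?e_gt0 // => l.
rewrite ltnS nth_rcons => /andP[l0]; case: (ltngtP l (size e)) => // ltl _.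
by apply: ltn_e; rewrite l0.
Qed.

(** Induction on [p]. The quantity [ops n p] bounds both the time in units and the samples consumed;
    the last clause leaves enough tape for what follows. *)
Lemma compileP p e s m : wf (size e) p -> env_ok e -> (size e <= 8)%N -> rep e s m ->
  (ops n p <= size (tp m))%N ->
  exists t s', [/\ exec w (compile (size e) p) s t s', (t <= ops n p * unit_cost)%N,
    rep e s' (sem e p m) & (size (tp m) <= size (tp (sem e p m)) + ops n p)%N].
Proof.
elim: p e s m => [x b|o x y z|x a r c|a r c x|x|p IHp q IHq|x p IHp|b p IHp] e s m /=.
- move=> ltx eok _ rs _; eexists; eexists; split; first by apply: ExecBasic; reflexivity.
  + have : (x < 64)%N by lia.
    by move/bitlen_cell; rewrite /ops /= /unit_cost; lia.
  + exact: rep_set_sc.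
  + by rewrite /=; lia.
- case/and3P=> ltx lty ltz eok _ rs _; eexists; eexists.
  split; first by apply: ExecBasic; reflexivity.
  + have : (x < 64)%N by lia. have : (y < 64)%N by lia. have : (z < 64)%N by lia.
    by do !move/bitlen_cell => ?; rewrite /ops /= /unit_cost; lia.
  + by rewrite !(rep_sc rs) //; exact: rep_set_sc.
  + by rewrite /=; lia.
- case/and4P=> ltx lta r_ok c_ok eok sz_e rs _.
  have [|s1 [run E4 Ei Ef Et]] := address_run eok rs _ lta r_ok c_ok; first by lia.
  have [t1 ex1 le1] := block_runP run.
  have [_ _ ltn_e] := eok; have ltr := ltn_e _ r_ok; have ltc := ltn_e _ c_ok.
  eexists; eexists; split; first by apply: ExecSeq ex1 _; apply: ExecBasic; reflexivity.
  + have : (x < 64)%N by lia.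
    move/bitlen_cell => bx; have := bitlen_cell (isT : (4 < 64)%N) => b4.
    have : (imem s1 4 <= top)%N by rewrite E4 /base /top; nia.
    move/bitlen_le => b5; rewrite /ops /= in le1 *.
    move: le1; rewrite /unit_cost; set L := bitlen top in b5 *; lia.
  + rewrite /= E4 Ef (rep_ar rs) //; apply: rep_set_sc => //; exact: rep_imem Ef Et.
  + by rewrite /=; lia.
- case/and4P=> ltx lta r_ok c_ok eok sz_e rs _.
  have [|s1 [run E4 Ei Ef Et]] := address_run eok rs _ lta r_ok c_ok; first by lia.
  have [t1 ex1 le1] := block_runP run.
  have [_ _ ltn_e] := eok; have ltr := ltn_e _ r_ok; have ltc := ltn_e _ c_ok.
  eexists; eexists; split; first by apply: ExecSeq ex1 _; apply: ExecBasic; reflexivity.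
  + have : (x < 64)%N by lia.
    move/bitlen_cell => bx; have := bitlen_cell (isT : (4 < 64)%N) => b4.
    have : (imem s1 4 <= top)%N by rewrite E4 /base /top; nia.
    move/bitlen_le => b5; rewrite /ops /= in le1 *.
    move: le1; rewrite /unit_cost; set L := bitlen top in b5 *; lia.
  + rewrite /= E4 Ef (rep_sc rs) //; apply: rep_set_ar => //; exact: rep_imem Ef Et.
  + by rewrite /=; lia.
- move=> ltx eok _ rs le_tp; have Et := rep_tp rs.
  case tm: (tp m) le_tp => [|v r] //= _.
  eexists; eexists; split.
  + by apply: ExecBasic; rewrite /= Et tm; reflexivity.
  + have : (x < 64)%N by lia.
    by move/bitlen_cell; rewrite /ops /= /unit_cost; lia.
  + case: (rep_set_sc v ltx rs) => b o en Es Ea _; split=> //=.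
  + by rewrite /ops /=; lia.
- case/andP=> wfp wfq eok sz_e rs le_tp.
  have le_ops : (ops n p + ops n q <= ops n (PSeq p q))%N.
    rewrite /ops /= mulnDl leq_add // leq_mul2l leq_pexp2l ?orbT //; lia.
  have [|t1 [s1 [ex1 le1 rs1 tp1]]] := IHp e s m wfp eok sz_e rs; first by lia.
  have [|t2 [s2 [ex2 le2 rs2 tp2]]] := IHq e s1 _ wfq eok sz_e rs1; first by lia.
  exists (t1 + t2)%N, s2; split=> //; last by lia.
    exact: ExecSeq ex1 ex2.
  by rewrite (leq_trans (leq_add le1 le2)) // -mulnDl leq_mul2r le_ops orbT.
- case/andP=> ltx wfp eok sz_e rs le_tp.
  have le_ops : (ops n p + 2 <= ops n (PIfNonzero x p))%N.
    by rewrite /ops /= mulnDl leq_add2l leq_pmulr // expn_gt0 n0.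
  have := bitlen_cell (_ : x < 64)%N => bx.
  have le_t : (test_cost w (Tfzero x) s <= unit_cost)%N.
    by rewrite /= /unit_cost; have := bx; lia.
  have Eh : holds (Tfzero x) s = (sc m x == 0) by rewrite /= (rep_sc rs).
  have U1 : (1 <= unit_cost)%N by rewrite /unit_cost; lia.
  case: ifP => Ex.
    exists (test_cost w (Tfzero x) s + 1)%N, s; split=> //; last by lia.
      by apply: ExecIf; rewrite Eh Ex; exact: ExecSkip.
    apply: (@leq_trans (2 * unit_cost)); first by lia.
    by rewrite leq_mul2r (leq_trans _ le_ops) ?leq_addl ?orbT.
  have [|t1 [s1 [ex1 le1 rs1 tp1]]] := IHp e s m wfp eok sz_e rs; first by lia.
  exists (test_cost w (Tfzero x) s + t1)%N, s1; split=> //; last by lia.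
    by apply: ExecIf; rewrite Eh Ex.
  have := leq_mul le_ops (leqnn unit_cost); rewrite mulnDl; lia.
- case/and3P=> ltb lt8 wfp eok sz_e rs le_tp.
  set k := size e in ltb lt8 wfp *.
  pose N := nth 0%N e b; pose f (m : fstate F) v := sem (rcons e v) p m.
  have leNn : (N <= n)%N by apply: env_le.
  have n_top : (n <= top)%N by rewrite /top; nia.
  have lt_lv l : (l <= k)%N -> (lv l < 64)%N by rewrite /lv; lia.
  have le_ops : ((ops n p + 2) * n + 2 <= ops n (PFor b p))%N.
    rewrite /ops /= expnS; have : (0 < n ^ depth p)%N by rewrite expn_gt0 n0.
    nia.
  have test_ok v s1 m1 : (v <= N)%N -> imem s1 (lv k) = v -> rep e s1 m1 ->
      imem s1 (lv b) = N /\ (test_cost w (Tlt (lv k) (lv b)) s1 <= unit_cost)%N.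
    move=> lev Ev rs1; have Eb : imem s1 (lv b) = N by apply: (rep_env rs1).
    split=> //; have := bitlen_cell (lt_lv k (leqnn _)); have := bitlen_cell (lt_lv b (ltnW ltb)).
    have : (v <= top)%N by lia. have : (N <= top)%N by lia.
    by do 2!move/bitlen_le => ?; rewrite /unit_cost /= Ev Eb; lia.
  (* [v] is the counter and [d] the number of passes left; a pass costs the body, the test and the
     increment. *)
  have loop d : forall v s1 m1, (v + d = N)%N -> imem s1 (lv k) = v -> rep e s1 m1 ->
     ((ops n p + 2) * d <= size (tp m1))%N ->
     exists t s', [/\ exec w (While (Tlt (lv k) (lv b))
           (Seq (compile k.+1 p) (Basic (Iop Iadd (lv k) (lv k) 3)))) s1 t s',
       (t <= ((ops n p + 2) * d + 1) * unit_cost)%N,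
       rep e s' (foldl f m1 (iota v d)) &
       (size (tp m1) <= size (tp (foldl f m1 (iota v d))) + (ops n p + 2) * d)%N].
    elim: d => [|d IHd] v s1 m1 Ed Ev rs1 le1.
      have [|Eb le_test] := test_ok v s1 m1 _ Ev rs1; first by lia.
      exists (test_cost w (Tlt (lv k) (lv b)) s1), s1; rewrite muln0 add0n mul1n addn0.
      by split=> //=; apply: ExecWhileF; rewrite /= Ev Eb; lia.
    have [|Eb le_test] := test_ok v s1 m1 _ Ev rs1; first by lia.
    have ltv : (v < n)%N by lia.
    rewrite mulnS in le1.
    have wfp' : wf (size (rcons e v)) p by rewrite size_rcons.
    have [||t1 [s2 [ex1 le_t1 rs2 tp1]]] :=
      IHp (rcons e v) s1 m1 wfp' (env_ok_rcons eok ltv) _ (rep_push rs1 Ev).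
    - by rewrite size_rcons.
    - by lia.
    (* The relation [rep] for the extended environment says that the body preserved the counter. *)
    have Ek : imem s2 (lv k) = v.
      by rewrite (rep_env rs2) ?size_rcons // nth_rcons ltnn eqxx.
    have E3 := rep_one rs2.
    have le_add : (instr_cost w (Iop Iadd (lv k) (lv k) 3) s2 <= unit_cost)%N.
      by apply: iop_unit; rewrite ?lt_lv //; split; rewrite ?lt_lv ?Ek ?E3 //; lia.
    pose s3 := set_icell s2 (lv k) v.+1.
    have [||||t2 [s4 [ex2 le_t2 rs4 tp2]]] := IHd v.+1 s3 (f m1 v).
    - by lia.
    - by rewrite /s3 /= eqxx.
    - by apply: rep_counter; exact: rep_rcons rs2.
    - by move: tp1 le1; rewrite -/(f m1 v); lia.
    exists (test_cost w (Tlt (lv k) (lv b)) s1 +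
            (t1 + instr_cost w (Iop Iadd (lv k) (lv k) 3) s2) + t2)%N, s4; split=> //.
    + apply: ExecWhileT ex2; first by rewrite /= Ev Eb; lia.
      apply: ExecSeq; first by rewrite size_rcons in ex1; exact: ex1.
      by apply: ExecBasic; rewrite /s3 /= Ek E3 addn1.
    + move: le_t1 le_test le_add le_t2; rewrite mulnS.
      by rewrite -[(ops n p + 2 + _ + 1)%N]addnA [((ops n p + 2 + _) * _)%N]mulnDl mulnDl; lia.
    + rewrite (_ : foldl f m1 (iota v d.+1) = foldl f (f m1 v) (iota v.+1 d)) // mulnS.
      by move: tp1 tp2; rewrite -/(f m1 v); lia.
  have le_dn : ((ops n p + 2) * N <= (ops n p + 2) * n)%N by rewrite leq_mul2l leNn orbT.
  have [||||t1 [s1 [ex1 le_t1 rs1 tp1]]] := loop N 0%N (set_icell s (lv k) 0) m.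
  - by [].
  - by rewrite /= eqxx.
  - exact: rep_counter.
  - by lia.
  exists (instr_cost w (Iset (lv k) 0) s + t1)%N, s1; split=> //.
  + by apply: ExecSeq ex1; apply: ExecBasic.
  + have le_set : (instr_cost w (Iset (lv k) 0) s <= unit_cost)%N.
      have b0 : (bitlen 0 <= 6)%N by apply: bitlen_cell.
      by have := bitlen_cell (lt_lv k (leqnn _)); rewrite [instr_cost _ _ _]/= /unit_cost; lia.
    apply: (@leq_trans (((ops n p + 2) * N + 2) * unit_cost)).
      by move: le_set le_t1; rewrite !mulnDl; lia.
    by rewrite leq_mul2r; apply/orP; right; lia.
  + by move: tp1; rewrite -/f -/N; lia.
Qed.
End Compile.

(** * Loading the input *)


(* Moves A out of the low cells, which then serve as scalars. Cell 0 is the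
   scratch cell of the copy: it is overwritten only after being read. *)
Definition copy_step : seq instr :=
  [:: Fload 0 6; Iop Iadd 4 2 6; Fstore 4 0; Iop Iadd 6 6 3].

(** Cell 7 is still zero, so the last addition copies n into cell 8, which is [lv 0]. Cell 5 holds
    n^2 and cell 6 the number of entries copied. *)
Definition prologue : cmd :=
  Seq (block [:: Iset 3 1; Iset 4 16; Iop Imul 5 0 0; Iop Iadd 2 5 4; Iop Iadd 8 0 7])
      (While (Tlt 6 5) (block copy_step)).

Section Prologue.
Variables (F : fieldType) (n d w : nat).
Hypothesis n0 : (0 < n)%N.
Variables (A : 'M[F]_n) (r : seq F).
Local Notation U := (unit_cost n w).

Record copied (q : nat) (s : state F) : Prop := Copied {
  copied_base : imem s 2 = base n;
  copied_one : imem s 3 = 1%N;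
  copied_size : imem s 5 = (n * n)%N;
  copied_idx : imem s 6 = q;
  copied_n : imem s 8 = n;
  copied_new p : (p < q)%N -> fmem s (base n + p)%N = nth 0 (entries A) p;
  copied_old p : (q <= p < n * n)%N -> fmem s p = nth 0 (entries A) p;
  copied_tape : tape s = r }.

Lemma copy_stepP q s : (q < n * n)%N -> copied q s ->
  exists2 s', block_run n w copy_step s s' & copied q.+1 s'.
Proof.
move=> ltq [Eb E1 E5 E6 E8 new old Et].
have bq : (bitlen q <= bitlen (top n))%N by apply: bitlen_le; rewrite /top; nia.
have bb : (bitlen (base n + q) <= bitlen (top n))%N.
  by apply: bitlen_le; rewrite /base /top; nia.
have lt0 := bitlen_cell (isT : (0 < 64)%N).
have lt4 := bitlen_cell (isT : (4 < 64)%N).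
have lt6 := bitlen_cell (isT : (6 < 64)%N).
eexists.
{ do ![eapply BlockCons; [reflexivity | | ]]; try exact: BlockNil.
  - by rewrite [instr_cost _ _ _]/= E6 /unit_cost; lia.
  - by apply: iop_unit => //; split=> //=; rewrite ?Eb ?E6 /base /top; nia.
  - by rewrite [instr_cost _ _ _]/= Eb E6 /unit_cost; lia.
  - by apply: iop_unit => //; split=> //=; rewrite ?E1 ?E6 /top; nia. }
split=> //=.
- by rewrite E6 E1 addn1.
- move=> p; rewrite ltnS leq_eqVlt Eb E6 eqn_add2l; case: eqP => [-> _|_ /= ltp].
    by rewrite old ?leqnn ?ltq.
  by rewrite new // /base; case: eqP => //; lia.
- move=> p /andP[ltqp ltp]; rewrite Eb E6 /base; case: eqP => [|_]; first by lia.
  by case: p ltqp ltp => // p ltqp ltp; apply: old; rewrite ltp ltnW.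
Qed.

Lemma copy_test q s : (q <= n * n)%N -> copied q s -> (test_cost w (Tlt 6 5) s <= U)%N.
Proof.
move=> leq cs; rewrite [test_cost _ _ _]/= (copied_size cs) (copied_idx cs).
have := bitlen_cell (isT : (6 < 64)%N); have := bitlen_cell (isT : (5 < 64)%N).
have : (q <= top n)%N by rewrite /top; nia.
have : (n * n <= top n)%N by rewrite /top; nia.
by do 2!move/bitlen_le => ?; rewrite /unit_cost; lia.
Qed.

Lemma copyP k : forall q s, (q + k = n * n)%N -> copied q s ->
  exists t s', [/\ exec w (While (Tlt 6 5) (block copy_step)) s t s',
    (t <= (6 * k + 1) * U)%N & copied (n * n) s'].
Proof.
elim: k => [|k IH] q s Eq cs.
  have /copy_test/(_ cs) le_test : (q <= n * n)%N by lia.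
  exists (test_cost w (Tlt 6 5) s), s; rewrite muln0 add0n mul1n; rewrite addn0 in Eq.
  split=> //; last by rewrite -Eq.
  by apply: ExecWhileF; rewrite /= (copied_size cs) (copied_idx cs) Eq ltnn.
have ltq : (q < n * n)%N by lia.
have /copy_test/(_ cs) le_test := ltnW ltq.
have [s1 run cs1] := copy_stepP ltq cs.
have [t1 ex1 le1] := block_runP n0 run.
have [|t2 [s2 [ex2 le2 cs2]]] := IH q.+1 s1 _ cs1; first by lia.
exists (test_cost w (Tlt 6 5) s + t1 + t2)%N, s2; split=> //.
  by apply: ExecWhileT ex1 ex2; rewrite /= (copied_size cs) (copied_idx cs).
by move: le1 le2; rewrite [size _]/= mulnS !mulnDl; lia.
Qed.

Lemma prologueP : exists t s' m,
  [/\ exec w prologue (initial d A r) t s', (t <= 13 * n ^ 2 * U)%N, rep n [:: n] s' m,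
      forall i j : 'I_n, ar m 0 i j = A i j & tp m = r].
Proof.
have lt_top q : (q <= 22)%N -> (q <= top n)%N by rewrite /top; nia.
have le_n : (n <= top n)%N by rewrite /top; nia.
have [s1 run cs1] : exists2 s1, block_run n w
    [:: Iset 3 1; Iset 4 16; Iop Imul 5 0 0; Iop Iadd 2 5 4; Iop Iadd 8 0 7]
    (initial d A r) s1 & copied 0 s1.
  eexists.
  { do ![eapply BlockCons; [reflexivity | | ]]; try exact: BlockNil.
    1,2: rewrite [instr_cost _ _ _]/= /unit_cost.
    - by have := bitlen_cell (isT : (3 < 64)%N); have := bitlen_cell (isT : (1 < 64)%N); lia.
    - by have := bitlen_cell (isT : (4 < 64)%N); have := bitlen_cell (isT : (16 < 64)%N); lia.
    all: by apply: iop_unit => //; split=> //=; rewrite /top; nia. }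
  by split; rewrite /= ?addn0.
have [t1 ex1 le1] := block_runP n0 run.
have [|t2 [s2 [ex2 le2 cs2]]] := copyP (k := n * n) (q := 0) _ cs1; first by [].
pose m := FState (fmem s2) (fun a i j => fmem s2 (base n + ((a * n + i) * n + j))%N) (tape s2).
exists (t1 + t2)%N, s2, m; split.
- exact: ExecSeq ex1 ex2.
(* Six units for the initial block, one for the last test, and six for each entry copied. *)
- apply: (@leq_trans ((7 + 6 * (n * n)) * U)); first by move: le1 le2; rewrite !mulnDl /=; lia.
  by rewrite leq_mul2r; apply/orP; right; rewrite -mulnn; nia.
- case: cs2 => b o _ _ en _ _ _; split=> // -[|l] //= _; exact: en.
- move=> i j; rewrite /= mul0n add0n (copied_new cs2) ?nth_entries //.
  by have := ltn_ord i; have := ltn_ord j; nia.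
- exact: copied_tape cs2.
Qed.

Lemma compiled_run p : wf 1 p -> (ops n p <= size r)%N ->
  exists t s' m, [/\ exec w (Seq prologue (compile 1 p)) (initial d A r) t s',
    (t <= (13 * n ^ 2 + ops n p) * U)%N,
    fmem s' 0 = sc (sem [:: n] p m) 0,
    forall i j : 'I_n, ar m 0 i j = A i j & tp m = r].
Proof.
move=> wfp le_r; have [t1 [s1 [m [ex1 le1 rs1 Ea Et]]]] := prologueP.
have eok : env_ok n [:: n] by split=> // -[|l].
have [||t2 [s2 [ex2 le2 rs2 _]]] := @compileP _ _ w n0 p [:: n] s1 m wfp eok _ rs1.
- by [].
- by rewrite Et.
exists (t1 + t2)%N, s2, m; split=> //.
- exact: ExecSeq ex1 ex2.
- by rewrite mulnDl leq_add.
- exact: (rep_sc rs2).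
Qed.
End Prologue.

(** * The program and its semantics *)


Fixpoint written_sc (p : prog) : seq nat :=
  match p with
  | PConst x _ | POp _ x _ _ | PLoad x _ _ _ | PSample x => [:: x]
  | PSeq p q => written_sc p ++ written_sc q
  | PIfNonzero _ p | PFor _ p => written_sc p
  | _ => [::]
  end.

Fixpoint written_ar (p : prog) : seq nat :=
  match p with
  | PStore a _ _ _ => [:: a]
  | PSeq p q => written_ar p ++ written_ar q
  | PIfNonzero _ p | PFor _ p => written_ar p
  | _ => [::]
  end.

(** * Frame properties and the loop rule *)

Section Frame.
Variable F : fieldType.
Implicit Types (p q : prog) (m : fstate F) (e : seq nat).

Lemma sem_seq e p q m : sem e (PSeq p q) m = sem e q (sem e p m).
Proof. by []. Qed.

Lemma sem_sc e p m x : x \notin written_sc p -> sc (sem e p m) x = sc m x.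
Proof.
elim: p e m => [y b|o y z t|y a r c|a r c y|y|p IHp q IHq|y p IHp|b p IHp] e m //=.
1-4: by rewrite inE => /negPf->.
- by rewrite mem_cat => /norP[nxp nxq]; rewrite IHq ?IHp.
- by case: ifP => // _; exact: IHp.
- by move=> nx; elim: (iota _ _) m => //= v s IHs m; rewrite IHs IHp.
Qed.

Lemma sem_ar e p m a : a \notin written_ar p -> ar (sem e p m) a = ar m a.
Proof.
elim: p e m => [y b|o y z t|y a' r c|a' r c y|y|p IHp q IHq|y p IHp|b p IHp] e m //=.
- by rewrite inE => /negPf->.
- by rewrite mem_cat => /norP[nxp nxq]; rewrite IHq ?IHp.
- by case: ifP => // _; exact: IHp.
- by move=> nx; elim: (iota _ _) m => //= v s IHs m; rewrite IHs IHp.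
Qed.

(** A Hoare rule with a built-in frame: whatever the body never writes still has its value from
    before the loop. *)
Lemma sem_for (Q : nat -> fstate F -> Prop) e b p m :
  Q 0%N m ->
  (forall v m', (v < nth 0 e b)%N ->
     (forall x, x \notin written_sc p -> sc m' x = sc m x) ->
     (forall a, a \notin written_ar p -> ar m' a = ar m a) ->
     Q v m' -> Q v.+1 (sem (rcons e v) p m')) ->
  Q (nth 0%N e b) (sem e (PFor b p) m).
Proof.
move=> Q0 QS.
suff gen k v m' : (v + k = nth 0 e b)%N ->
    (forall x, x \notin written_sc p -> sc m' x = sc m x) ->
    (forall a, a \notin written_ar p -> ar m' a = ar m a) ->
    Q v m' -> Q (nth 0%N e b) (foldl (fun m v => sem (rcons e v) p m) m' (iota v k)).
  exact: (gen _ 0%N).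
elim: k v m' => [|k IHk] v m' Ev Hs Ha Qv /=; first by rewrite -Ev addn0.
apply: IHk => [|x nx|a na|]; first by rewrite addSnnS.
- by rewrite sem_sc ?Hs.
- by rewrite sem_ar ?Ha.
- by apply: QS => //; lia.
Qed.
End Frame.

Local Notation "p ;; q" := (PSeq p q) (at level 60, right associativity).

Definition sample_points : prog := PFor 0 (PSample 3 ;; PStore 3 1 1 3).

Definition shift_diag (o : fop) : prog :=
  PFor 0 (PLoad 3 0 2 2 ;; POp o 3 3 1 ;; PStore 0 2 2 3).

Definition init_inverse : prog :=
  PConst 8 false ;; PConst 9 true ;;
  PFor 0 (PFor 0 (PStore 1 2 3 8) ;; PStore 1 2 2 9).

(** Within the row programs, counter 1 is the sample point, counter 2 the row [j], and counters 3
    and 4 belong to the local loops. *)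
Definition row_coords : prog :=
  PFor 0 (PConst 2 false ;;
          PFor 0 (PLoad 3 0 2 4 ;; PLoad 4 1 4 3 ;; POp Fmul 3 3 4 ;; POp Fadd 2 2 3) ;;
          PStore 2 3 3 2).

(** The recurrence of [oddsum_mixedS] divided by the new determinant [c j * \det (mixed A j)]: the
    ratio in scalar 5 gains each term with [i < j], divided by the pivot. *)
Definition add_pairs : prog :=
  PFor 2 (PConst 2 false ;;
          PFor 0 (PLoad 3 0 3 4 ;; POp Fmul 3 3 3 ;; PLoad 4 1 4 3 ;; POp Fmul 3 3 4 ;;
                  PLoad 4 1 4 2 ;; POp Fmul 3 3 4 ;; POp Fadd 2 2 3) ;;
          PLoad 3 2 3 3 ;; POp Fmul 2 3 2 ;; POp Fdiv 2 2 7 ;; POp Fadd 5 5 2).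

(** The inner loop also overwrites column [j], so the quotient [M k j / c j] is kept in scalar 2 and
    stored there last. *)
Definition update_inverse : prog :=
  PFor 0 (PLoad 2 1 3 2 ;; POp Fdiv 2 2 7 ;;
          PFor 0 (PLoad 3 2 4 4 ;; POp Fmul 3 3 2 ;; PLoad 4 1 3 4 ;; POp Fsub 4 4 3 ;;
                  PStore 1 3 4 4) ;;
          PStore 1 3 2 2).

Definition replace_row : prog :=
  row_coords ;; PLoad 7 2 2 2 ;; add_pairs ;; POp Fmul 6 6 7 ;; update_inverse.

(** The test skips a zero denominator, which for distinct points occurs only at the current
    point. *)
Definition lagrange_weight : prog :=
  PConst 2 true ;;
  PFor 0 (PLoad 3 3 2 2 ;; POp Fsub 4 3 1 ;;
          PIfNonzero 4 (POp Fdiv 3 3 4 ;; POp Fmul 2 2 3)).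

(** The shift is made in place and undone after the row loop, so array 0 holds A again for the next
    point. *)
Definition eval_point : prog :=
  PLoad 1 3 1 1 ;; shift_diag Fadd ;; init_inverse ;;
  PConst 5 false ;; PConst 6 true ;; PFor 0 replace_row ;; shift_diag Fsub ;;
  lagrange_weight ;; POp Fmul 2 2 5 ;; POp Fmul 2 2 6 ;; POp Fadd 0 0 2.

(* Arrays: 0 holds A, 1 the current inverse, and the diagonals of 2 and 3 the
   coordinates c of the new row and the sample points x. Scalars: 0 is the
   result, 1 the sample point, 5 the ratio oddsum / det, 6 the determinant and
   7 the pivot c_j. *)
Definition oddsum_prog : prog := sample_points ;; PConst 0 false ;; PFor 0 eval_point.

Section Semantics.
Variables (F : fieldType) (n : nat).
Implicit Types (m : fstate F).

Lemma sample_pointsP m s : (s < n)%N ->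
  ar (sem [:: n] sample_points m) 3 s s = nth 0 (tp m) s.
Proof.
pose Q v m' := tp m' = drop v (tp m) /\
  forall s, (s < v)%N -> ar m' 3 s s = nth 0 (tp m) s.
suff [_ H] : Q n (sem [:: n] sample_points m) by exact: H.
apply: (@sem_for _ Q [:: n] 0); first by split=> //; rewrite drop0.
move=> v m' _ _ _ [Et Ea]; split=> /=; first by rewrite Et -drop1 drop_drop add1n.
move=> t; rewrite ltnS leq_eqVlt andbb Et.
by case: eqP => [->|_ /Ea//]; rewrite -nth0 nth_drop addn0.
Qed.

Lemma shift_diagP o s m r c : (r < n)%N ->
  ar (sem [:: n; s] (shift_diag o) m) 0 r c =
    if r == c then fop_fun o (ar m 0 r c) (sc m 1) else ar m 0 r c.
Proof.
move=> ltr; pose Q v m' := forall r c, ar m' 0 r c =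
  if (r == c) && (r < v)%N then fop_fun o (ar m 0 r c) (sc m 1) else ar m 0 r c.
suff H : Q n (sem [:: n; s] (shift_diag o) m) by rewrite H ltr andbT.
apply: (@sem_for _ Q [:: n; s] 0) => [i j|v m' _ Es _ Q' i j]; first by rewrite andbF.
rewrite /= Q' Es // ltnn andbF Q' ltnS [(i <= v)%N]leq_eqVlt.
case: (eqVneq i v) => [->|] //=.
by rewrite [j == v]eq_sym; case: (eqVneq v j) => [->|].
Qed.

Lemma init_inverseP s m k i : (k < n)%N -> (i < n)%N ->
  ar (sem [:: n; s] init_inverse m) 1 k i = (k == i)%:R.
Proof.
move=> ltk lti; rewrite !sem_seq; set m1 := sem _ _ (sem _ _ m).
have E8 : sc m1 8 = 0 by [].
have E9 : sc m1 9 = 1 by [].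
pose Q v m' := forall k i, (k < v)%N -> (i < n)%N -> ar m' 1 k i = (k == i)%:R.
suff H : Q n (sem [:: n; s] (PFor 0 (PFor 0 (PStore 1 2 3 8) ;; PStore 1 2 2 9)) m1) by exact: H.
apply: (@sem_for _ Q [:: n; s] 0) => // v m' _ Es _ Q' k' i' ltk' lti'.
rewrite sem_seq; set m2 := sem _ (PFor _ _) m'.
have E29 : sc m2 9 = 1 by rewrite sem_sc // Es.
have E2 : ar m2 1 k' i' = if k' == v then 0 else ar m' 1 k' i'.
  pose Q3 u m'' := forall i, ar m'' 1 k' i = if (k' == v) && (i < u)%N then 0 else ar m' 1 k' i.
  suff H : Q3 n m2 by rewrite H lti' andbT.
  apply: (@sem_for _ Q3 (rcons [:: n; s] v) 0) => [c|u m3 _ Es3 _ Q3' c]; first by rewrite andbF.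
  rewrite /= Q3' Es3 // Es // E8 ltnS [(c <= u)%N]leq_eqVlt.
  by case: (k' == v); case: (c == u).
rewrite /= E29 E2; case: (eqVneq k' v) => [->|nk] /=; first by rewrite eq_sym; case: eqP.
by apply: Q' => //; rewrite ltn_neqAle nk -ltnS.
Qed.

Lemma row_coordsP s j m i : (i < n)%N ->
  ar (sem [:: n; s; j] row_coords m) 2 i i = \sum_(0 <= k < n) ar m 0 j k * ar m 1 k i.
Proof.
pose Q v m' := forall i, (i < v)%N ->
  ar m' 2 i i = \sum_(0 <= k < n) ar m 0 j k * ar m 1 k i.
move=> lti; suff H : Q n (sem [:: n; s; j] row_coords m) by exact: H.
apply: (@sem_for _ Q [:: n; s; j] 0) => // v m' _ _ Ea Q' i' lti'.
rewrite !sem_seq; set m1 := sem _ (PConst _ _) m'; set m2 := sem _ (PFor _ _) m1.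
have E1 : sc m1 2 = 0 by [].
have E2 : sc m2 2 = \sum_(0 <= k < n) ar m 0 j k * ar m 1 k v.
  pose Q2 u m'' := sc m'' 2 = \sum_(0 <= k < u) ar m 0 j k * ar m 1 k v.
  apply: (@sem_for _ Q2 (rcons [:: n; s; j] v) 0) => [|u m3 _ _ Ea3 Q2'].
    by rewrite /Q2 big_geq.
  by rewrite /Q2 big_nat_recr //= -Q2' !Ea3 // !Ea.
rewrite /= E2; have -> : ar m2 2 = ar m' 2 by rewrite sem_ar.
move: lti'; rewrite ltnS leq_eqVlt andbb; case: eqP => [->//|_ /=]; exact: Q'.
Qed.

Lemma add_pairsP s j m : (j < n)%N ->
  sc (sem [:: n; s; j] add_pairs m) 5 = sc m 5 + \sum_(0 <= i < j)
    (ar m 2 i i * \sum_(0 <= k < n) ar m 0 i k ^+ 2 * ar m 1 k i * ar m 1 k j) / sc m 7.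
Proof.
move=> ltj; set term := BIG_F; pose Q v m' := sc m' 5 = sc m 5 + \sum_(0 <= i < v) term i.
apply: (@sem_for _ Q [:: n; s; j] 2) => [|v m' _ Es Ea Q']; first by rewrite /Q big_geq // addr0.
rewrite !sem_seq; set m1 := sem _ (PConst _ _) m'; set m2 := sem _ (PFor _ _) m1.
have E2 : sc m2 2 = \sum_(0 <= k < n) ar m 0 v k ^+ 2 * ar m 1 k v * ar m 1 k j.
  pose Q2 u m'' := sc m'' 2 = \sum_(0 <= k < u) ar m 0 v k ^+ 2 * ar m 1 k v * ar m 1 k j.
  apply: (@sem_for _ Q2 (rcons [:: n; s; j] v) 0) => [|u m3 _ _ Ea3 Q2'].
    by rewrite /Q2 big_geq.
  by rewrite /Q2 big_nat_recr //= -Q2' !Ea3 // !Ea // expr2.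
have E25 : sc m2 5 = sc m' 5 by rewrite sem_sc.
have E27 : sc m2 7 = sc m 7 by rewrite sem_sc //= Es.
have Ea2 : ar m2 2 = ar m 2 by rewrite sem_ar //= Ea.
by rewrite /Q big_nat_recr //= E2 E25 E27 Ea2 addrA -Q'.
Qed.

Lemma update_inverseP s j m k i : (k < n)%N -> (i < n)%N -> (j < n)%N ->
  ar (sem [:: n; s; j] update_inverse m) 1 k i =
    if i == j then ar m 1 k j / sc m 7
    else ar m 1 k i - ar m 2 i i * (ar m 1 k j / sc m 7).
Proof.
move=> ltk lti ltj; pose t k := ar m 1 k j / sc m 7.
pose Q v m' := forall k i, (i < n)%N -> ar m' 1 k i =
  if (k < v)%N then if i == j then t k else ar m 1 k i - ar m 2 i i * t k else ar m 1 k i.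
suff H : Q n (sem [:: n; s; j] update_inverse m) by rewrite H // ltk.
apply: (@sem_for _ Q [:: n; s; j] 0) => // v m' _ Es Ea Q' k' i' lti'.
rewrite !sem_seq; set m1 := sem _ (POp _ _ _ _) _; set m2 := sem _ (PFor _ _) m1.
have E1 : sc m1 2 = t v by rewrite /= Es // Q' // ltnn.
have Ea1 : ar m1 1 = ar m' 1 by [].
have Ea1' : ar m1 2 = ar m 2 by rewrite /= Ea.
have E22 : sc m2 2 = t v by rewrite sem_sc.
have E2 r c : (c < n)%N -> ar m2 1 r c =
    if r == v then ar m' 1 r c - ar m 2 c c * t v else ar m' 1 r c.
  pose Q2 u m'' := forall r c, ar m'' 1 r c =
    if (r == v) && (c < u)%N then ar m' 1 r c - ar m 2 c c * t v else ar m' 1 r c.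
  move=> ltc; suff H : Q2 n m2 by rewrite H ltc andbT.
  apply: (@sem_for _ Q2 (rcons [:: n; s; j] v) 0) => [r' c'|u m3 _ Es3 Ea3 Q2' r' c'].
    by rewrite andbF Ea1.
  rewrite /= !Q2' Ea3 // Ea1' Es3 // E1 ltnn andbF ltnS [(c' <= u)%N]leq_eqVlt.
  by case: (eqVneq r' v) => [->|]; case: (eqVneq c' u) => [->|].
rewrite /= E22 E2 // !Q' // ltnS [(k' <= v)%N]leq_eqVlt.
case: (eqVneq k' v) => [->|] //=; rewrite ltnn.
by case: (eqVneq i' j).
Qed.

Lemma lagrange_weightP s m :
  sc (sem [:: n; s] lagrange_weight m) 2 =
    \prod_(0 <= t < n | ar m 3 t t != sc m 1) (ar m 3 t t / (ar m 3 t t - sc m 1)).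
Proof.
rewrite sem_seq; set m1 := sem _ (PConst _ _) m.
pose Q v m' := sc m' 2 =
  \prod_(0 <= t < v | ar m 3 t t != sc m 1) (ar m 3 t t / (ar m 3 t t - sc m 1)).
apply: (@sem_for _ Q [:: n; s] 0) => [|v m' _ Es Ea Q']; first by rewrite /Q big_geq.
rewrite /Q big_mkcond big_nat_recr //= -big_mkcond /= -Q' Ea // Es //= subr_eq0.
by case: (ar m 3 v v == sc m 1) => //=; rewrite mulr1.
Qed.


Definition mx_ar m a : 'M[F]_n := \matrix_(r, c) ar m a r c.

(** The invariant of the loop over the rows. *)
Definition inv_at (A : 'M[F]_n) (j : nat) m : Prop :=
  [/\ mx_ar m 0 = A, mixed A j *m mx_ar m 1 = 1%:M, \det (mixed A j) = sc m 6
    & oddsum (mixed A j) = sc m 6 * sc m 5].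

Hypothesis F2 : 1 + 1 = 0 :> F.

Lemma replace_rowP (A : 'M[F]_n) s (j : 'I_n) m :
  \det (mixed A j.+1) != 0 -> inv_at A j m ->
  inv_at A j.+1 (sem [:: n; s; nat_of_ord j] replace_row m).
Proof.
move=> nd [EA XM Ed Eo]; pose M := mx_ar m 1; pose c i := \sum_k A j k * M k i.
have ArA (r k : 'I_n) : ar m 0 r k = A r k by rewrite -EA mxE.
have ArM (r k : 'I_n) : ar m 1 r k = M r k by rewrite mxE.
have Edet := det_mixedS XM; rewrite -/(c j) in Edet.
(* The next determinant is the pivot times the present one. *)
have nc : c j != 0 by apply: contraNneq nd => cj0; rewrite Edet cj0 mul0r.
rewrite /replace_row !sem_seq.
set m1 := sem _ row_coords m; set m2 := sem _ (PLoad _ _ _ _) m1.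
set m3 := sem _ add_pairs m2; set m4 := sem _ (POp _ _ _ _) m3; set m5 := sem _ _ m4.
have Ec (i : 'I_n) : ar m1 2 i i = c i.
  rewrite row_coordsP // big_mkord; apply: eq_bigr => k _; by rewrite ArA ArM.
have a0 : ar m1 0 = ar m 0 by rewrite sem_ar.
have a1 : ar m1 1 = ar m 1 by rewrite sem_ar.
have s5 : sc m1 5 = sc m 5 by rewrite sem_sc.
have s6 : sc m1 6 = sc m 6 by rewrite sem_sc.
have s27 : sc m2 7 = c j by rewrite /= Ec.
have s37 : sc m3 7 = c j by rewrite sem_sc.
have s36 : sc m3 6 = sc m 6 by rewrite sem_sc // -s6.
have a30 : ar m3 0 = ar m 0 by rewrite sem_ar.
have a31 : ar m3 1 = ar m 1 by rewrite sem_ar.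
have a32 : ar m3 2 = ar m1 2 by rewrite sem_ar.
have s56 : sc m5 6 = sc m 6 * c j by rewrite sem_sc //= s36 s37.
have s55 : sc m5 5 = sc m 5 + \sum_(i < n | (i < j)%N)
    (c i * \sum_k A i k ^+ 2 * M k i * M k j) / c j.
  rewrite sem_sc //= add_pairsP // s27 /= s5; congr (_ + _).
  rewrite (big_nat_widen _ _ n) ?(ltnW (ltn_ord j)) // big_mkord; apply: eq_bigr => i _.
  rewrite /= Ec; congr (_ * _ / _); rewrite big_mkord; apply: eq_bigr => k _.
  by rewrite a0 a1 ArA !ArM.
have E1 : mx_ar m5 1 = upd_inv M j c.
  apply/matrixP=> k i; rewrite !mxE update_inverseP // [ar m4 _]a31 [ar m4 2]a32 [sc m4 7]s37.
  by rewrite (inj_eq val_inj) Ec !ArM !mxE.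
split.
- by apply/matrixP=> r k; rewrite mxE sem_ar // [ar m4 0]a30 ArA.
- by rewrite E1; apply: mixedS_inv.
- by rewrite Edet s56 Ed mulrC.
- rewrite (oddsum_mixedS F2 XM) Ed Eo s56 s55 -/(c j) mulrDr; congr (_ + _).
    by rewrite mulrA [c j * _]mulrC.
  rewrite -[RHS]mulrA; congr (_ * _); rewrite big_distrr /=; apply: eq_bigr => i _.
  by rewrite [RHS]mulrC divfK.
Qed.

Lemma eval_pointP (A : 'M[F]_n) (s : 'I_n) m (x := ar m 3 s s) :
  mx_ar m 0 = A -> good_shift A x ->
  let m' := sem [:: n; nat_of_ord s] eval_point m in
  [/\ mx_ar m' 0 = A, ar m' 3 = ar m 3 &
    sc m' 0 = sc m 0 + oddsum (A + x%:M) *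
      \prod_(0 <= t < n | ar m 3 t t != x) (ar m 3 t t / (ar m 3 t t - x))].
Proof.
move=> EA /forallP good m'.
have ArA (r k : 'I_n) : ar m 0 r k = A r k by rewrite -EA mxE.
rewrite /m' /eval_point 10!sem_seq.
set m1 := sem _ (PLoad _ _ _ _) m; set m2 := sem _ (shift_diag _) m1.
set m3 := sem _ init_inverse m2; set m4 := sem _ (PConst 6 _) _.
set m5 := sem _ (PFor _ _) m4; set m6 := sem _ (shift_diag _) m5.
set m7 := sem _ lagrange_weight m6.
have s1 : sc m1 1 = x by [].
have I0 : inv_at (A + x%:M) 0 m4.
  rewrite /inv_at mixed0 det1 oddsum1 /= mulr0; split=> //.
    apply/matrixP=> r k; rewrite mxE /= sem_ar // shift_diagP // s1 !mxE ArA (inj_eq val_inj).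
    by case: (r == k); rewrite ?mulr1n ?mulr0n ?addr0.
  by rewrite mul1mx; apply/matrixP=> r k; rewrite !mxE /= init_inverseP.
have In : inv_at (A + x%:M) n m5.
  apply: (@sem_for _ (inv_at (A + x%:M)) [:: n; nat_of_ord s] 0) => // v mv ltv _ _ Iv.
  exact: (replace_rowP (j := Ordinal ltv) _ _ Iv).
case: In; rewrite mixedn => E0 _ _ Eo.
have s21 : sc m2 1 = x by rewrite sem_sc.
have s31 : sc m3 1 = x by rewrite sem_sc.
have s51 : sc m5 1 = x by rewrite sem_sc //; exact: s31.
have E60 : mx_ar m6 0 = A.
  apply/matrixP=> r k; rewrite mxE shift_diagP // s51.
  have := congr1 (fun B : 'M_n => B r k) E0; rewrite !mxE (inj_eq val_inj) => ->.
  by case: (r == k); rewrite ?mulr1n ?mulr0n ?addr0 //= addrK.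
have a3 : ar m6 3 = ar m 3 by rewrite !sem_ar //= !sem_ar.
have s61 : sc m6 1 = x by rewrite sem_sc.
have s6_ : sc m6 0 = sc m 0 by rewrite !sem_sc //= !sem_sc.
have s72 : sc m7 2 = \prod_(0 <= t < n | ar m 3 t t != x) (ar m 3 t t / (ar m 3 t t - x)).
  by rewrite lagrange_weightP a3 s61.
split.
- by rewrite -E60; apply/matrixP=> r k; rewrite !mxE /= sem_ar.
- by rewrite -a3 /= sem_ar.
- have s70 : sc m7 0 = sc m 0 by rewrite sem_sc // s6_.
  have s75 : sc m7 5 = sc m5 5 by rewrite sem_sc // sem_sc.
  have s76 : sc m7 6 = sc m5 6 by rewrite sem_sc // sem_sc.
  by rewrite /= s70 s72 s75 s76 Eo; congr (_ + _); rewrite -mulrA mulrC [_ * sc m5 6]mulrC.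
Qed.

Lemma oddsum_progP (A : 'M[F]_n) m (x := fun s : 'I_n => nth 0 (tp m) s) :
  mx_ar m 0 = A -> injective x -> (forall s, good_shift A (x s)) ->
  sc (sem [:: n] oddsum_prog m) 0 = oddsum A.
Proof.
move=> EA x_inj good; rewrite /oddsum_prog !sem_seq.
set m1 := sem _ sample_points m; set m2 := sem _ (PConst _ _) m1.
have Ex (s : 'I_n) : ar m2 3 s s = x s by rewrite /= sample_pointsP.
(* Scalar 0 accumulates the Lagrange sum over the first [v] points. *)
pose Q v m' := [/\ mx_ar m' 0 = A, ar m' 3 = ar m2 3 &
  sc m' 0 = \sum_(s < n | (s < v)%N)
    oddsum (A + (x s)%:M) * \prod_(t | t != s) (x t / (x t - x s))].
have [_ _ ->] : Q n (sem [:: n] (PFor 0 eval_point) m2).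
  apply: (@sem_for _ Q [:: n] 0).
    split=> //; last by rewrite big_pred0.
    by rewrite -EA; apply/matrixP=> r k; rewrite !mxE /= sem_ar.
  move=> v m3 ltv _ _ [E0 E3 Es].
  pose s := Ordinal ltv; have Exs : ar m3 3 s s = x s by rewrite E3 -Ex.
  rewrite -[rcons _ _]/[:: n; nat_of_ord s].
  have [|E0' E3' Es'] := @eval_pointP A s m3 E0; first by rewrite Exs.
  split; [exact: E0' | by rewrite E3' |]; rewrite Exs in Es'.
  rewrite Es' Es [RHS](bigD1 s) //= [RHS]addrC; congr (_ + _).
    by apply: eq_bigl => t; rewrite ltnS -(inj_eq val_inj) /= ltn_neqAle andbC.
  (* For distinct points the test on values agrees with [t != s]. *)
  congr (_ * _); rewrite big_mkord; apply: eq_big => t.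
    by rewrite E3 Ex (inj_eq x_inj).
  by rewrite E3 Ex.
have A0 : A + 0%:M = A by apply/matrixP=> r k; rewrite !mxE mul0rn addr0.
rewrite -[A in RHS]A0 -horner_oddpoly.
rewrite (lagrange0 x_inj (size_oddpoly A)); apply: eq_big => s; rewrite ?ltn_ord //.
by rewrite horner_oddpoly.
Qed.

End Semantics.

(** * Success probability and running time *)


Section Counting.
Variables (F : finType) (T : nat).
Implicit Types r : T.-tuple F.

Definition set_tnth r (i : 'I_T) (v : F) : T.-tuple F :=
  [tuple if j == i then v else tnth r j | j < T].

Lemma tnth_set_tnth r i v j : tnth (set_tnth r i v) j = if j == i then v else tnth r j.
Proof. by rewrite tnth_mktuple. Qed.

(* Exchanging coordinate i with a fresh value is an involution, so a uniform
   tuple may be drawn by filling in coordinate i last. *)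
Lemma card_coordinate (E : pred (T.-tuple F)) (i : 'I_T) (S : T.-tuple F -> {set F}) m :
  (forall r v, E (set_tnth r i v) -> v \in S r) -> (forall r, (#|S r| <= m)%N) ->
  (#|E| * #|F| <= #|F| ^ T * m)%N.
Proof.
move=> ES leS; pose h (rv : T.-tuple F * F) := (set_tnth rv.1 i rv.2, tnth rv.1 i).
have hK : involutive h.
  case=> r v; rewrite /h /= tnth_set_tnth eqxx; congr (_, _).
  by apply: eq_from_tnth => j; rewrite !tnth_set_tnth; case: eqP => [->|].
have -> : (#|E| * #|F| = \sum_(rv : T.-tuple F * F) E rv.1)%N.
  rewrite -(pair_bigA _ (fun r (v : F) => nat_of_bool (E r))) /=.
  under eq_bigr do rewrite sum_nat_const mulnC.
  rewrite -big_distrl /=; congr (_ * _)%N; rewrite -sum1_card big_mkcond /=.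
  by apply: eq_bigr => r _; rewrite -[r \in E]/(E r); case: (E r).
rewrite (reindex_inj (inv_inj hK)) /=.
rewrite -(pair_bigA _ (fun r v => nat_of_bool (E (set_tnth r i v)))) /=.
rewrite -card_tuple -sum_nat_const; apply: leq_sum => r _.
apply: leq_trans (leS r); rewrite -sum1_card [leqRHS]big_mkcond /=.
by apply: leq_sum => v _; case Er: (E _) => //; rewrite (ES _ _ Er).
Qed.
End Counting.

(** A bad tape has, for some [s < n], an entry [s] that is a bad shift or repeats another of the
    first n entries. With the rest of the tape fixed, this allows at most n^2 + n - 1 values. *)
Lemma card_bad_tape (F : finFieldType) n T (A : 'M[F]_n) (leT : (n <= T)%N)
    (good := fun r : T.-tuple F => injectiveb (fun s : 'I_n => nth 0 r s) &&
       [forall s : 'I_n, good_shift A (nth 0 r s)]) :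
  (#|[pred r | ~~ good r]| * #|F| <= #|F| ^ T * (2 * n ^ 3))%N.
Proof.
pose w := widen_ord leT; pose Bad := [set x | ~~ good_shift A x]%SET.
have nthE (r : T.-tuple F) (s : 'I_n) : nth 0 r s = tnth r (w s) by rewrite (tnth_nth 0).
pose others (r : T.-tuple F) (s : 'I_n) := [set tnth r (w t) | t in predC1 s]%SET.
pose E s := [pred r : T.-tuple F | tnth r (w s) \in Bad :|: others r s].
have cE s : (#|E s| * #|F| <= #|F| ^ T * (n * n + n.-1))%N.
  apply: (@card_coordinate _ _ _ (w s) (fun r => Bad :|: others r s)) => [r v|r].
    rewrite /= tnth_set_tnth eqxx !inE => /orP[->//|/imsetP[t nts ->]]; apply/orP; right.
    (* Changing entry [s] does not affect [others r s]. *)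
    apply/imsetP; exists t => //; rewrite tnth_set_tnth.
    by rewrite -(inj_eq val_inj) /= (inj_eq val_inj) (negPf nts).
  apply: (leq_trans (leq_card_setU _ _)); apply: leq_add.
    by rewrite cardsE card_bad_shift.
  by rewrite (leq_trans (leq_imset_card _ _)) // cardC1 card_ord.
have sub : [pred r | ~~ good r] \subset (\bigcup_s [set r in E s])%SET.
  apply/fintype.subsetP=> r; rewrite inE negb_and => /orP[/injectivePn[s [t nst]]|].
    rewrite !nthE => Est; apply/bigcupP; exists s => //; rewrite !inE; apply/orP; right.
    by apply/imsetP; exists t; rewrite ?inE // eq_sym.
  rewrite negb_forall => /existsP[s]; rewrite nthE => bad.
  by apply/bigcupP; exists s => //; rewrite !inE bad.
apply: (@leq_trans ((\sum_s #|E s|) * #|F|)).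
  rewrite leq_mul2r (leq_trans (subset_leq_card sub)) ?orbT //.
  elim/big_rec2: _ => [|s m C _ IH]; first by rewrite cards0.
  by rewrite (leq_trans (leq_card_setU _ _)) // cardsE leq_add2l.
rewrite big_distrl /=; apply: (@leq_trans (\sum_(s < n) #|F| ^ T * (n * n + n.-1))).
  by apply: leq_sum => s _.
rewrite sum_nat_const card_ord mulnCA leq_mul2l; apply/orP; right.
by case: n {A leT good w Bad nthE others E cE sub} => // n; rewrite /=; nia.
Qed.

Section F2quot.
Variables (g : {poly 'F_2}) (irr_g : irreducible_poly g).

Lemma F2quot_char2 : 1 + 1 = 0 :> F2quot irr_g.
Proof.
have: (1 + 1) *: 1 = 0 :> {poly %/ g with irreducible_F2_monic irr_g}.
  by rewrite (_ : 1 + 1 = 0) ?scale0r //; apply/val_inj.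
by rewrite scalerDl !scale1r.
Qed.

Lemma card_F2quot d : size g = d.+1 -> #|F2quot irr_g| = (2 ^ d)%N.
Proof. by move=> sz_g; rewrite card_qfpoly card_Fp // sz_g. Qed.
End F2quot.

(** * The running time in soft-O form *)

Section Bound.
Variable R : realType.

Lemma bitlen_ln (k : nat) : (0 < k)%N -> (bitlen k)%:R <= 1 + ln k%:R / ln 2 :> R.
Proof.
move=> k0; rewrite /bitlen -addn1 natrD addrC lerD2l ler_pdivlMr ?ln_gt0 ?ltr1n //.
rewrite mulr_natl -lnXn // -natrX ler_ln ?posrE ?ltr0n ?expn_gt0 //.
by rewrite ler_nat; case/andP: (trunc_log_bounds (isT : (1 < 2)%N) k0).
Qed.

(* X plays the role of n^(2 + omega) d. *)
Lemma time_bound (C0 : R) (k0 c n d w : nat) (X : R) : (0 < n)%N -> (0 < d)%N ->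
  w%:R <= soft C0 k0 d%:R -> n%:R ^+ 4 * d%:R <= X ->
  (c * n ^ 4 * unit_cost n w)%:R <=
    soft (c%:R * (53 + `|C0| * ln 2 ^+ k0) / ln 2 ^+ k0.+2) k0.+2 X.
Proof.
move=> n0 d0 le_w le_X.
have l2 : 0 < ln 2 :> R by rewrite ln_gt0 ?ltr1n.
have n1 : 1 <= n%:R :> R by rewrite ler1n.
have d1 : 1 <= d%:R :> R by rewrite ler1n.
have n4 : 1 <= n%:R ^+ 4 :> R by rewrite exprn_ege1.
have le_dX : d%:R <= X by apply: le_trans le_X; rewrite ler_peMl ?ler0n.
have le_n2X : n%:R ^+ 2 <= X.
  apply: le_trans le_X; rewrite (le_trans (ler_weXn2l n1 (isT : (2 <= 4)%N))) //.
  by rewrite ler_peMr // exprn_ge0.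
have X1 : 1 <= X by apply: le_trans le_dX.
have [mu mu1 lnE] : exists2 mu, 1 <= mu & ln (2 + X) = mu * ln 2.
  exists (ln (2 + X) / ln 2); last by rewrite mulfVK // gt_eqF.
  by rewrite ler_pdivlMr // mul1r ler_ln ?posrE; lra.
(* Since X >= 1, 22 <= (2 + X)^3, so 22 n^2 <= (2 + X)^4; the fifth [mu] absorbs the extra bit. *)
have le_b : (bitlen (top n))%:R <= 5 * mu.
  apply: (le_trans (bitlen_ln _)); first by rewrite /top; nia.
  have : ln (top n)%:R <= ln ((2 + X) ^+ 4).
    rewrite ler_ln ?posrE ?ltr0n ?exprn_gt0 //; try lra; last by rewrite /top; nia.
    rewrite /top natrM natrX.
    have := ler_pM (ler0n R 22) (exprn_ge0 2 (ler0n R n)) (_ : 22 <= (2 + X) ^+ 3) le_n2X.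
    move=> H; apply: (le_trans (H _)); first by nra.
    by rewrite [leRHS]exprSr ler_wpM2l ?exprn_ge0; lra.
  rewrite lnXn; last by lra.
  have -> : ln (2 + X) *+ 4 = 4 * mu * ln 2 by rewrite lnE; ring.
  by rewrite -ler_pdivrMr // => le_ln; lra.
have le_w' : w%:R <= `|C0| * d%:R * (mu ^+ k0 * ln 2 ^+ k0).
  apply: (le_trans le_w); rewrite /soft -exprMn -lnE.
  have ln_d : 0 <= ln (2 + d%:R) :> R by rewrite ln_ge0; lra.
  apply: (@le_trans _ _ (`|C0| * d%:R * ln (2 + d%:R) ^+ k0)).
    by rewrite !ler_wpM2r ?exprn_ge0 ?ler_norm.
  rewrite ler_wpM2l ?mulr_ge0 ?ler0n // lerXn2r ?nnegrE // ?ler_ln ?posrE; try lra.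
  by apply: ln_ge0; lra.
have mk1 : 1 <= mu ^+ k0 by rewrite exprn_ege1.
have le_U : (unit_cost n w)%:R <= (53 + `|C0| * ln 2 ^+ k0) * mu ^+ k0.+2 * d%:R.
  rewrite /unit_cost !natrD !natrM; set b := (bitlen _)%:R in le_b *.
  have b0 : 0 <= b by rewrite ler0n.
  (* With [b <= 5 * mu] and [mu >= 1], the constant is 18 + 10 + 25. *)
  have le_18 : 18 + 2 * b + b * b <= 53 * mu ^+ 2 by nra.
  rewrite [leRHS](_ : _ = 53 * mu ^+ k0.+2 * d%:R + `|C0| * ln 2 ^+ k0 * mu ^+ k0.+2 * d%:R); last by ring.
  rewrite lerD //.
    apply: (le_trans le_18).
    have -> : mu ^+ k0.+2 = mu ^+ k0 * mu ^+ 2 by rewrite -exprD addn2.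
    have -> : 53 * (mu ^+ k0 * mu ^+ 2) * d%:R = mu ^+ k0 * d%:R * (53 * mu ^+ 2) by ring.
    by rewrite ler_peMl ?mulr_ege1 // mulr_ge0 // exprn_ge0; lra.
  apply: (le_trans le_w').
  have : mu ^+ k0 <= mu ^+ k0.+2 by rewrite ler_weXn2l // leqW.
  set a := `|C0|; set L := ln 2 ^+ k0; set p := mu ^+ k0; set q := mu ^+ _ => le_pq.
  rewrite (_ : a * d%:R * (p * L) = a * L * d%:R * p); last by ring.
  rewrite (_ : a * L * q * d%:R = a * L * d%:R * q); last by ring.
  by rewrite ler_wpM2l // !mulr_ge0 ?normr_ge0 ?exprn_ge0 ?ler0n // ltW.
rewrite /soft lnE exprMn; set L := ln 2 ^+ k0.+2; set q := mu ^+ _ in le_U *.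
set K := 53 + _ in le_U *.
have L0 : L != 0 by rewrite gt_eqF ?exprn_gt0.
have q0 : 0 <= q by rewrite exprn_ge0; lra.
have K0 : 0 <= K by rewrite addr_ge0 // mulr_ge0 ?exprn_ge0 // ltW.
have -> : c%:R * K / L * X * (q * L) = c%:R * K * q * X by field.
rewrite natrM [(c * _)%:R]natrM natrX.
apply: (@le_trans _ _ (c%:R * n%:R ^+ 4 * (K * q * d%:R))).
  by rewrite ler_wpM2l // mulr_ge0 ?exprn_ge0 ?ler0n.
have -> : c%:R * n%:R ^+ 4 * (K * q * d%:R) = c%:R * K * q * (n%:R ^+ 4 * d%:R) by ring.
exact: ler_wpM2l (mulr_ge0 (mulr_ge0 (ler0n _ _) K0) q0) _ _ le_X.
Qed.
End Bound.

Theorem lemma11 (R : realType) :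
  exists P : cmd,
  forall fieldcost : nat -> nat,
  (exists (C0 : R) (k0 : nat), forall d : nat, (0 < d)%N ->
     (fieldcost d)%:R <= soft C0 k0 d%:R) ->
  exists (C : R) (k : nat),
  forall (n d : nat) (g : {poly 'F_2}) (irr_g : irreducible_poly g),
  (0 < n)%N -> (0 < d)%N -> size g = d.+1 ->
  forall A : 'M[F2quot irr_g]_n,
  exists T : nat,
    [/\ T%:R <= soft C k (n%:R `^ (2 + omega R) * d%:R),
        forall r : T.-tuple (F2quot irr_g), exists y : F2quot irr_g,
          returns_within (fieldcost d) P (initial d A r) T y
      & 1 - 2 ^ (1 - d%:Z) * n%:R ^+ 3 <=
        Pr R (fun r : T.-tuple (F2quot irr_g) =>
                returns_within (fieldcost d) P (initial d A r) T
                  (pcc (n%:Z - 1) A))].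
Proof.
exists (Seq prologue (compile 1 oddsum_prog)) => fieldcost [C0 [k0 costP]].
(* 13 accounts for the prologue, whose n^2 is absorbed into n^4. *)
pose c := (13 + weight oddsum_prog)%N.
exists (c%:R * (53 + `|C0| * ln 2 ^+ k0) / ln 2 ^+ k0.+2), k0.+2.
move=> n d g irr_g n0 d0 sz_g A; set w := fieldcost d.
(* [T] is both the time bound and the tape length, so the samples cannot run out. *)
pose T := (c * n ^ 4 * unit_cost n w)%N.
have n1 : 1 <= n%:R :> R by rewrite ler1n.
have unit1 : (1 <= unit_cost n w)%N by rewrite /unit_cost; lia.
have n41 : (0 < n ^ 4)%N by rewrite expn_gt0 n0.
(* The nesting depth is four: sample point, row and two inner indices. *)
have opsE : ops n oddsum_prog = (weight oddsum_prog * n ^ 4)%N by [].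
have le_opsT : (ops n oddsum_prog <= T)%N.
  by rewrite opsE /T -mulnA leq_mul ?leq_addl // leq_pmulr.
have leT : (n <= T)%N.
  apply: leq_trans le_opsT; rewrite opsE (@leq_trans (n ^ 4)%N) ?leq_pmull //.
  by rewrite -[leqLHS]expn1 leq_pexp2l.
have runs (r : T.-tuple (F2quot irr_g)) : exists m,
    [/\ returns_within w (Seq prologue (compile 1 oddsum_prog)) (initial d A r) T
           (sc (sem [:: n] oddsum_prog m) 0), mx_ar n m 0 = A & tp m = r].
  have [|t [s' [m [ex le_t E0 EA Et]]]] :=
    @compiled_run _ n d w n0 A r oddsum_prog isT; first by rewrite size_tuple.
  exists m; split=> //; last by apply/matrixP=> i j; rewrite mxE EA.
  exists t, s'; split=> //; apply: (leq_trans le_t); rewrite leq_mul2r; apply/orP; right.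
  by rewrite opsE /c [leqRHS]mulnDl leq_add2r leq_mul2l leq_pexp2l.
exists T; split.
- apply: (@time_bound R C0 k0 c n d w _ n0 d0 (costP d d0)).
  (* n^4 <= n^(2 + omega), as omega >= 2 and n >= 1. *)
  rewrite ler_wpM2r ?ler0n // -powR_mulrn ?ler0n // ler_powR //.
  have := omega_ge2 R; lra.
(* Every tape gives a run within the time bound, division by zero being total; a bad tape can only
   spoil the value. *)
- by move=> r; have [m [ret _ _]] := runs r; exists (sc (sem [:: n] oddsum_prog m) 0).
pose good (r : T.-tuple (F2quot irr_g)) := injectiveb (fun s : 'I_n => nth 0 r s) &&
  [forall s : 'I_n, good_shift A (nth 0 r s)].
have goodP r : good r -> returns_within w (Seq prologue (compile 1 oddsum_prog))
    (initial d A r) T (pcc (n%:Z - 1) A).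
  case/andP=> /injectiveP x_inj /forallP x_good; have [m [ret Em Et]] := runs r.
  rewrite pcc_oddsum -(oddsum_progP (F2quot_char2 irr_g) Em) ?Et //.
have cardF := card_F2quot irr_g sz_g.
have := card_bad_tape A leT; rewrite /= cardF => le_bad.
rewrite /Pr card_tuple cardF; set E := [pred r | _].
have le_good : (#|[pred r | good r]| <= #|E|)%N.
  by apply/subset_leq_card/fintype.subsetP => r good_r; apply/asboolP; exact: goodP.
have cC : (#|[pred r | good r]| + #|[pred r | ~~ good r]| = (2 ^ d) ^ T)%N.
  by rewrite -cardF -card_tuple -(cardC [pred r | good r]).
have q0 : 0 < (2 ^ d)%:R :> R by rewrite ltr0n expn_gt0.
have qT0 : 0 < ((2 ^ d) ^ T)%:R :> R by rewrite ltr0n !expn_gt0.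
have -> : 2 ^ (1 - d%:Z) = 2 / (2 ^ d)%:R :> R.
  by rewrite expfzDr ?pnatr_eq0 // expr1z -exprnN natrX.
have {}le_bad : #|[pred r | ~~ good r]|%:R <=
    ((2 ^ d) ^ T)%:R * (2 * n%:R ^+ 3) / (2 ^ d)%:R :> R.
  by rewrite ler_pdivlMr // -[n%:R ^+ 3]natrX -[2 * _]natrM -!natrM ler_nat.
rewrite ler_pdivlMr // [leLHS](_ : _ =
  ((2 ^ d) ^ T)%:R - ((2 ^ d) ^ T)%:R * (2 * n%:R ^+ 3) / (2 ^ d)%:R); last by ring.
have := congr1 (fun q => q%:R : R) cC; rewrite natrD.
move: le_good; rewrite -(ler_nat R); lra.
Qed.
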